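(* Let $\Bbbk$ be a field of characteristic $p>0$, let $U$ be the Hopf algebra over $\Bbbk$ and $M(l,i)$ ($1\leq l\leq p$, $i\in\mathbb{Z}_p$) the $U$-modules defined in the context, and let $r,r'\in\mathbb{Z}_p$. (1) Let $1\leq l\leq m\leq p$ and $l+m\leq p$. Then, as $U$-modules, $$M(l,r)\otimes M(m,r')\cong\bigoplus_{i=1}^{l} M(m-l-1+2i,\ r+r'+l-i).$$ (2) Let $1\leq l\leq m\leq p$ and $l+m>p$. Then, as $U$-modules, $$M(l,r)\otimes M(m,r')\cong\Big(\bigoplus_{i=1}^{p-m} M(m-l-1+2i,\ r+r'+l-i)\Big)\oplus\Big(\bigoplus_{i=1}^{l+m-p} M(p,\ r+r'+i-1)\Big).$$
   Context: $U$ is the $\Bbbk$-algebra generated by $u$ and $w$ subject to $u^p=0$, $w^p=w$, $wu-uw=u$. It is a Hopf algebra of dimension $p^2$ with $u$ and $w$ primitive: $\Delta(u)=u\otimes 1+1\otimes u$, $\Delta(w)=w\otimes 1+1\otimes w$, $\varepsilon(u)=\varepsilon(w)=0$, $S(u)=-u$, $S(w)=-w$. $\mathbb{Z}_p=\mathbb{Z}/(p)$ is regarded as the prime subfield of $\Bbbk$. For $1\leq l\leq p$ and $i\in\mathbb{Z}_p$, $M(l,i)$ is the left $U$-module with $\Bbbk$-basis $x_1,\dots,x_l$ (standard basis) and action $w\cdot x_j=(i+j-1)x_j$ for $1\leq j\leq l$, $u\cdot x_j=x_{j+1}$ for $1\leq j\leq l-1$, $u\cdot x_l=0$. Tensor products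 are over $\Bbbk$, with $U$ acting through $\Delta$. In the second coordinate of $M(\cdot,\cdot)$ integers are read modulo $p$. An empty direct sum is $0$. *)

(* Defs.v *)
From HB Require Import structures.
From mathcomp Require Import all_boot all_order all_algebra.
From mathcomp Require Import boolp.

Set Implicit Arguments.
Unset Strict Implicit.
Unset Printing Implicit Defensive.

Import GRing.Theory.
Local Open Scope ring_scope.
Local Open Scope quotient_scope.

(* Tensor product over k: formal k-combinations of symbols v (x) w modulo the
   congruence generated by the k-module axioms and bilinearity. *)

Section TensorTerms.
Variables (k : fieldType) (V W : lmodType k).

Inductive tterm :=
  | TZero
  | TPure of V & W
  | TAdd of tterm & tterm
  | TScale of k & tterm.

Inductive teq : tterm -> tterm -> Prop :=
  | teq_refl x : teq x x
  | teq_sym x y : teq x y -> teq y x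
  | teq_trans x y z : teq x y -> teq y z -> teq x z
  | teq_add x x' y y' : teq x x' -> teq y y' -> teq (TAdd x y) (TAdd x' y')
  | teq_scale c x x' : teq x x' -> teq (TScale c x) (TScale c x')
  | teq_addA x y z : teq (TAdd x (TAdd y z)) (TAdd (TAdd x y) z)
  | teq_addC x y : teq (TAdd x y) (TAdd y x)
  | teq_add0 x : teq (TAdd TZero x) x
  | teq_addN x : teq (TAdd (TScale (-1) x) x) TZero
  | teq_scaleA a b x : teq (TScale a (TScale b x)) (TScale (a * b) x)
  | teq_scale1 x : teq (TScale 1 x) x
  | teq_scaleDr a x y :
      teq (TScale a (TAdd x y)) (TAdd (TScale a x) (TScale a y))
  | teq_scaleDl a b x :
      teq (TScale (a + b) x) (TAdd (TScale a x) (TScale b x))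
  | teq_pureDl v v' w : teq (TPure (v + v') w) (TAdd (TPure v w) (TPure v' w))
  | teq_pureDr v w w' : teq (TPure v (w + w')) (TAdd (TPure v w) (TPure v w'))
  | teq_pureZl c v w : teq (TPure (c *: v) w) (TScale c (TPure v w))
  | teq_pureZr c v w : teq (TPure v (c *: w)) (TScale c (TPure v w)).

HB.instance Definition _ := gen_eqMixin tterm.
HB.instance Definition _ := gen_choiceMixin tterm.

Definition teqb (x y : tterm) : bool := `[<teq x y>].

Lemma teqb_equiv : equiv_class_of teqb.
Proof.
split=> [x|x y|y x z]; first exact/asboolP/teq_refl.
  by apply/asboolP/asboolP; apply: teq_sym.
by move=> /asboolP xy /asboolP yz; apply/asboolP; apply: teq_trans yz.
Qed.

Canonical teqb_equivRel := EquivRelPack teqb_equiv.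

Definition tensor : Type := {eq_quot teqb}.
HB.instance Definition _ := Choice.on tensor.

Definition tclass (x : tterm) : tensor := \pi_({eq_quot teqb}) x.
Definition trepr (x : tensor) : tterm := repr (x : {eq_quot teqb}).

Lemma treprK x : tclass (trepr x) = x.
Proof. exact: reprK. Qed.

Lemma tclassP x y : tclass x = tclass y <-> teq x y.
Proof.
split=> [/eqmodP/asboolP //|xy]; exact/eqmodP/asboolP.
Qed.

Lemma trepr_class x : teq (trepr (tclass x)) x.
Proof. by apply/tclassP; rewrite treprK. Qed.

Definition tzero := tclass TZero.
Definition tadd x y := tclass (TAdd (trepr x) (trepr y)).
Definition tscale c x := tclass (TScale c (trepr x)).
Definition topp x := tscale (-1) x.
Definition tpure v w := tclass (TPure v w).

Lemma taddE x y : tadd (tclass x) (tclass y) = tclass (TAdd x y).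
Proof. by apply/tclassP/teq_add; apply: trepr_class. Qed.

Lemma tscaleE c x : tscale c (tclass x) = tclass (TScale c x).
Proof. by apply/tclassP/teq_scale; apply: trepr_class. Qed.

Lemma tclassK (P : tensor -> Prop) :
  (forall x, P (tclass x)) -> forall x, P x.
Proof. by move=> h x; rewrite -[x]treprK. Qed.

Fact taddA : associative tadd.
Proof.
elim/tclassK=> x; elim/tclassK=> y; elim/tclassK=> z.
by rewrite !taddE; apply/tclassP/teq_addA.
Qed.

Fact taddC : commutative tadd.
Proof.
elim/tclassK=> x; elim/tclassK=> y.
by rewrite !taddE; apply/tclassP/teq_addC.
Qed.

Fact tadd0 : left_id tzero tadd.
Proof. by elim/tclassK=> x; rewrite taddE; apply/tclassP/teq_add0. Qed.

Fact taddN : left_inverse tzero topp tadd.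
Proof.
by elim/tclassK=> x; rewrite /topp tscaleE taddE; apply/tclassP/teq_addN.
Qed.

HB.instance Definition _ :=
  GRing.isZmodule.Build tensor taddA taddC tadd0 taddN.

Fact tscaleA a b x : tscale a (tscale b x) = tscale (a * b) x.
Proof.
by elim/tclassK: x => x; rewrite !tscaleE; apply/tclassP/teq_scaleA.
Qed.

Fact tscale1 : left_id 1 tscale.
Proof. by elim/tclassK=> x; rewrite tscaleE; apply/tclassP/teq_scale1. Qed.

Fact tscaleDr : right_distributive tscale +%R.
Proof.
move=> a; elim/tclassK=> x; elim/tclassK=> y.
rewrite -[_ + _]/(tadd _ _) -[RHS]/(tadd _ _) !(taddE, tscaleE).
exact/tclassP/teq_scaleDr.
Qed.

Fact tscaleDl x : {morph tscale^~ x : a b / a + b}.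
Proof.
move=> a b; elim/tclassK: x => x.
by rewrite -[RHS]/(tadd _ _) !(taddE, tscaleE); apply/tclassP/teq_scaleDl.
Qed.

HB.instance Definition _ := GRing.Zmodule_isLmodule.Build k tensor
  tscaleA tscale1 tscaleDr tscaleDl.

Lemma tpureDl v v' w : tpure (v + v') w = tpure v w + tpure v' w.
Proof.
by rewrite -[RHS]/(tadd _ _) taddE; apply/tclassP/teq_pureDl.
Qed.

Lemma tpureDr v w w' : tpure v (w + w') = tpure v w + tpure v w'.
Proof.
by rewrite -[RHS]/(tadd _ _) taddE; apply/tclassP/teq_pureDr.
Qed.

Lemma tpureZl c v w : tpure (c *: v) w = c *: tpure v w.
Proof.
by rewrite -[RHS]/(tscale _ _) tscaleE; apply/tclassP/teq_pureZl.
Qed.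

Lemma tpureZr c v w : tpure v (c *: w) = c *: tpure v w.
Proof.
by rewrite -[RHS]/(tscale _ _) tscaleE; apply/tclassP/teq_pureZr.
Qed.

Lemma tensor_ind (P : tensor -> Prop) :
  P 0 -> (forall v w, P (tpure v w)) ->
  (forall x y, P x -> P y -> P (x + y)) ->
  (forall c x, P x -> P (c *: x)) -> forall x, P x.
Proof.
move=> P0 Pp Pa Ps; elim/tclassK; elim=> [//|v w|x Px y Py|c x Px].
- exact: Pp.
- by rewrite -taddE; apply: Pa.
- by rewrite -tscaleE; apply: Ps.
Qed.

End TensorTerms.

Definition bilinear_fun (k : fieldType) (V W Z : lmodType k)
    (f : V -> W -> Z) : Prop :=
  [/\ forall v v' w, f (v + v') w = f v w + f v' w,
      forall v w w', f v (w + w') = f v w + f v w',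
      forall c v w, f (c *: v) w = c *: f v w
    & forall c v w, f v (c *: w) = c *: f v w].

Lemma bilinear0l (k : fieldType) (V W Z : lmodType k) (f : V -> W -> Z) w :
  bilinear_fun f -> f 0 w = 0.
Proof. by case=> _ _ Zl _; have := Zl 0 0 w; rewrite !scale0r. Qed.

Lemma bilinear0r (k : fieldType) (V W Z : lmodType k) (f : V -> W -> Z) v :
  bilinear_fun f -> f v 0 = 0.
Proof. by case=> _ _ _ Zr; have := Zr 0 v 0; rewrite !scale0r. Qed.

Lemma tpure_bilinear (k : fieldType) (V W : lmodType k) :
  bilinear_fun (@tpure k V W).
Proof.
by split; [exact: tpureDl | exact: tpureDr | exact: tpureZl | exact: tpureZr].
Qed.

Section TensorLift.
Variables (k : fieldType) (V W Z : lmodType k) (f : V -> W -> Z).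

Fixpoint teval (x : tterm V W) : Z :=
  match x with
  | TZero => 0
  | TPure v w => f v w
  | TAdd x y => teval x + teval y
  | TScale c x => c *: teval x
  end.

(* The linear map V (x) W -> Z induced by f, meaningful for bilinear f. *)
Definition tlift (x : tensor V W) : Z := teval (trepr x).

Hypothesis fB : bilinear_fun f.

Lemma teval_eq x y : teq x y -> teval x = teval y.
Proof.
case: fB => fDl fDr fZl fZr.
elim=> {x y} //=.
- by move=> x y z _ -> _ ->.
- by move=> x x' y y' _ -> _ ->.
- by move=> c x x' _ ->.
- by move=> *; rewrite addrA.
- by move=> *; rewrite addrC.
- by move=> *; rewrite add0r.
- by move=> *; rewrite scaleN1r addNr.
- by move=> *; rewrite scalerA.
- by move=> *; rewrite scale1r.
- by move=> *; rewrite scalerDr.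
- by move=> *; rewrite scalerDl.
Qed.

Lemma tlift_class x : tlift (tclass x) = teval x.
Proof. exact/teval_eq/trepr_class. Qed.

Lemma tlift_pure v w : tlift (tpure v w) = f v w.
Proof. exact: tlift_class. Qed.

Lemma tlift0 : tlift 0 = 0.
Proof. exact: tlift_class. Qed.

Lemma tliftD x y : tlift (x + y) = tlift x + tlift y.
Proof.
elim/tclassK: x => x; elim/tclassK: y => y.
by rewrite -[_ + _]/(tadd _ _) taddE !tlift_class.
Qed.

Lemma tliftZ c x : tlift (c *: x) = c *: tlift x.
Proof.
elim/tclassK: x => x.
by rewrite -[_ *: _]/(tscale _ _) tscaleE !tlift_class.
Qed.

End TensorLift.

(* The action (a (x) b)(v (x) w) = av (x) bw of A (x) B on V (x) W. *)

Section TensorAction.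
Variables (k : fieldType) (A B V W : lmodType k).
Variables (aV : A -> V -> V) (aW : B -> W -> W).
Hypotheses (aVB : bilinear_fun aV) (aWB : bilinear_fun aW).

Definition tact1 (a : A) (b : B) (x : tensor V W) : tensor V W :=
  tlift (fun v w => tpure (aV a v) (aW b w)) x.

Definition tact (t : tensor A B) (x : tensor V W) : tensor V W :=
  tlift (fun a b => tact1 a b x) t.

Let pureB a b : bilinear_fun (fun v w => tpure (aV a v) (aW b w)).
Proof.
case: aVB aWB => [_ Dr _ Zr] [_ Dr' _ Zr'].
split=> *.
- by rewrite Dr tpureDl.
- by rewrite Dr' tpureDr.
- by rewrite Zr tpureZl.
- by rewrite Zr' tpureZr.
Qed.

Let act1B x : bilinear_fun (fun a b => tact1 a b x).
Proof.
case: aVB aWB => [Dl _ Zl _] [Dl' _ Zl' _]; rewrite /tact1.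
split=> [a a' b|a b b'|c a b|c a b]; elim/tensor_ind: x.
- by rewrite !tlift0 // addr0.
- by move=> v w; rewrite !tlift_pure // Dl tpureDl.
- by move=> x y; rewrite !tliftD // => -> ->; rewrite addrACA.
- by move=> d x; rewrite !tliftZ // => ->; rewrite scalerDr.
- by rewrite !tlift0 // addr0.
- by move=> v w; rewrite !tlift_pure // Dl' tpureDr.
- by move=> x y; rewrite !tliftD // => -> ->; rewrite addrACA.
- by move=> d x; rewrite !tliftZ // => ->; rewrite scalerDr.
- by rewrite !tlift0 // scaler0.
- by move=> v w; rewrite !tlift_pure // Zl tpureZl.
- by move=> x y; rewrite !tliftD // => -> ->; rewrite scalerDr.
- by move=> d x; rewrite !tliftZ // => ->; rewrite !scalerA mulrC.
- by rewrite !tlift0 // scaler0.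
- by move=> v w; rewrite !tlift_pure // Zl' tpureZr.
- by move=> x y; rewrite !tliftD // => -> ->; rewrite scalerDr.
- by move=> d x; rewrite !tliftZ // => ->; rewrite !scalerA mulrC.
Qed.

Lemma tact_pure a b v w :
  tact (tpure a b) (tpure v w) = tpure (aV a v) (aW b w).
Proof. by rewrite /tact tlift_pure // /tact1 tlift_pure. Qed.

Lemma tact_bilinear : bilinear_fun tact.
Proof.
split=> [t t' x|t x x'|c t x|c t x].
- exact: tliftD.
- elim/tensor_ind: t => [|a b|t t' h h'|c t h].
  + by rewrite /tact !tlift0 // addr0.
  + by rewrite /tact !tlift_pure // /tact1 tliftD.
  + by move: h h'; rewrite /tact !(tliftD (act1B _)) => -> ->; rewrite addrACA.
  + by move: h; rewrite /tact !(tliftZ (act1B _)) => ->; rewrite scalerDr.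
- exact: tliftZ.
- elim/tensor_ind: t => [|a b|t t' h h'|d t h].
  + by rewrite /tact !tlift0 // scaler0.
  + by rewrite /tact !tlift_pure // /tact1 tliftZ.
  + by move: h h'; rewrite /tact !(tliftD (act1B _)) => -> ->; rewrite scalerDr.
  + move: h; rewrite /tact !(tliftZ (act1B _)) => ->.
    by rewrite !scalerA mulrC.
Qed.

End TensorAction.

Lemma mulr_bilinear (k : fieldType) (A : algType k) :
  bilinear_fun (fun a b : A => a * b).
Proof.
by split=> *; rewrite ?mulrDl ?mulrDr -?scalerAl -?scalerAr.
Qed.

(* (t s) . x = t . (s . x) for the multiplication of A (x) B; specialized to the
   regular action, it is the associativity of that multiplication. *)
Lemma tactM (k : fieldType) (A B : algType k) (V W : lmodType k)
    (aV : A -> V -> V) (aW : B -> W -> W) :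
  bilinear_fun aV -> bilinear_fun aW ->
  (forall a a' v, aV (a * a') v = aV a (aV a' v)) ->
  (forall b b' w, aW (b * b') w = aW b (aW b' w)) ->
  forall (t s : tensor A B) (x : tensor V W),
  tact aV aW (tact *%R *%R t s) x = tact aV aW t (tact aV aW s x).
Proof.
move=> aVB aWB aVM aWM t s x.
have xB := tact_bilinear aVB aWB; have [Dl Dr Zl Zr] := xB.
have mB := tact_bilinear (mulr_bilinear A) (mulr_bilinear B).
have [mDl mDr mZl mZr] := mB.
have Z0 y := bilinear0l y xB; have Z0r y := bilinear0r y xB.
have mZ0 y := bilinear0l y mB; have mZ0r y := bilinear0r y mB.
elim/tensor_ind: t => [|a b|t t' h h'|c t h]; first by rewrite mZ0 !Z0.
- elim/tensor_ind: s => [|a' b'|s s' h h'|c s h].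
  + by rewrite mZ0r !Z0 Z0r.
  + elim/tensor_ind: x => [|v w|x x' h h'|c x h]; first by rewrite !Z0r.
    * rewrite (tact_pure (mulr_bilinear A) (mulr_bilinear B)) !tact_pure //.
      by rewrite aVM aWM.
    * by rewrite !Dr h h'.
    * by rewrite !Zr h.
  + by rewrite mDr !Dl Dr h h'.
  + by rewrite mZr !Zl Zr h.
- by rewrite mDl !Dl h h'.
- by rewrite mZl !Zl h.
Qed.

Section TensorAlgebra.
Variables (k : fieldType) (A B : algType k).

Definition tensor_alg : Type := tensor A B.
HB.instance Definition _ := GRing.Lmodule.on tensor_alg.

Definition tone : tensor_alg := tpure 1 1.
Definition tmul (t s : tensor_alg) : tensor_alg := tact *%R *%R t s.

Let AB := mulr_bilinear A.
Let BB := mulr_bilinear B.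

Fact tmulA : associative tmul.
Proof.
by move=> t s x; rewrite /tmul tactM // => *; rewrite mulrA.
Qed.

Fact tmul1l : left_id tone tmul.
Proof.
have tB := tact_bilinear AB BB; have [_ Dr _ Zr] := tB.
elim/tensor_ind=> [|a b|x y hx hy|c x hx]; rewrite /tmul /tone.
- exact: bilinear0r.
- by rewrite tact_pure // !mul1r.
- by rewrite Dr; congr (_ + _).
- by rewrite Zr; congr (_ *: _).
Qed.

Fact tmul1r : right_id tone tmul.
Proof.
have tB := tact_bilinear AB BB; have [Dl _ Zl _] := tB.
elim/tensor_ind=> [|a b|x y hx hy|c x hx]; rewrite /tmul /tone.
- exact: bilinear0l.
- by rewrite tact_pure // !mulr1.
- by rewrite Dl; congr (_ + _).
- by rewrite Zl; congr (_ *: _).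
Qed.

Fact tmulDl : left_distributive tmul +%R.
Proof. by move=> x y z; have [Dl _ _ _] := tact_bilinear AB BB; apply: Dl. Qed.

Fact tmulDr : right_distributive tmul +%R.
Proof. by move=> x y z; have [_ Dr _ _] := tact_bilinear AB BB; apply: Dr. Qed.

(* Only a possibly trivial ring: nothing here needs 1 != 0 in A (x) B. *)
HB.instance Definition _ := GRing.Zmodule_isPzRing.Build tensor_alg
  tmulA tmul1l tmul1r tmulDl tmulDr.

Lemma tmul_pure a a' b b' :
  (tpure a b : tensor_alg) * (tpure a' b' : tensor_alg)
    = tpure (a * a') (b * b') :> tensor_alg.
Proof. exact: tact_pure. Qed.

Lemma tmulZl c (x y : tensor_alg) : (c *: x) * y = c *: (x * y).
Proof. by have [_ _ Zl _] := tact_bilinear AB BB; apply: Zl. Qed.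

Lemma tmulZr c (x y : tensor_alg) : x * (c *: y) = c *: (x * y).
Proof. by have [_ _ _ Zr] := tact_bilinear AB BB; apply: Zr. Qed.

Definition tconst (c : k) : tensor_alg := c *: (1 : tensor_alg).

Fact tconst_nmod : nmod_morphism tconst.
Proof. by split=> [|a b]; rewrite /tconst ?scale0r ?scalerDl. Qed.

Fact tconst_monoid : monoid_morphism tconst.
Proof.
split=> [|a b]; rewrite /tconst ?scale1r //.
by rewrite tmulZl mul1r scalerA.
Qed.

HB.instance Definition _ :=
  GRing.isNmodMorphism.Build k tensor_alg tconst tconst_nmod.
HB.instance Definition _ :=
  GRing.isMonoidMorphism.Build k tensor_alg tconst tconst_monoid.

Lemma tconst_central c x : GRing.comm (tconst c) x.
Proof. by rewrite /GRing.comm /tconst tmulZl tmulZr mul1r mulr1. Qed.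

End TensorAlgebra.

(* U: noncommutative polynomial expressions in u and w modulo the congruence
   generated by the axioms of k-algebras and the three defining relations. *)

Section UTerms.
Variables (k : fieldType) (p : nat).

Inductive uterm :=
  | Eu
  | Ew
  | EConst of k
  | EAdd of uterm & uterm
  | EMul of uterm & uterm.

Definition EOpp x := EMul (EConst (-1)) x.
Definition EPow x n := iter n (EMul x) (EConst 1).

Inductive ueq : uterm -> uterm -> Prop :=
  | ueq_refl x : ueq x x
  | ueq_sym x y : ueq x y -> ueq y x
  | ueq_trans x y z : ueq x y -> ueq y z -> ueq x z
  | ueq_add x x' y y' : ueq x x' -> ueq y y' -> ueq (EAdd x y) (EAdd x' y')
  | ueq_mul x x' y y' : ueq x x' -> ueq y y' -> ueq (EMul x y) (EMul x' y')
  | ueq_addA x y z : ueq (EAdd x (EAdd y z)) (EAdd (EAdd x y) z)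
  | ueq_addC x y : ueq (EAdd x y) (EAdd y x)
  | ueq_add0 x : ueq (EAdd (EConst 0) x) x
  | ueq_addN x : ueq (EAdd (EOpp x) x) (EConst 0)
  | ueq_mulA x y z : ueq (EMul x (EMul y z)) (EMul (EMul x y) z)
  | ueq_mul1l x : ueq (EMul (EConst 1) x) x
  | ueq_mul1r x : ueq (EMul x (EConst 1)) x
  | ueq_mulDl x y z : ueq (EMul (EAdd x y) z) (EAdd (EMul x z) (EMul y z))
  | ueq_mulDr x y z : ueq (EMul x (EAdd y z)) (EAdd (EMul x y) (EMul x z))
  | ueq_constD a b : ueq (EConst (a + b)) (EAdd (EConst a) (EConst b))
  | ueq_constM a b : ueq (EConst (a * b)) (EMul (EConst a) (EConst b))
  | ueq_constC c x : ueq (EMul (EConst c) x) (EMul x (EConst c))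
  | ueq_up : ueq (EPow Eu p) (EConst 0)
  | ueq_wp : ueq (EPow Ew p) Ew
  | ueq_wu : ueq (EAdd (EMul Ew Eu) (EOpp (EMul Eu Ew))) Eu.

HB.instance Definition _ := gen_eqMixin uterm.
HB.instance Definition _ := gen_choiceMixin uterm.

Definition ueqb (x y : uterm) : bool := `[<ueq x y>].

Lemma ueqb_equiv : equiv_class_of ueqb.
Proof.
split=> [x|x y|y x z]; first exact/asboolP/ueq_refl.
  by apply/asboolP/asboolP; apply: ueq_sym.
by move=> /asboolP xy /asboolP yz; apply/asboolP; apply: ueq_trans yz.
Qed.

Canonical ueqb_equivRel := EquivRelPack ueqb_equiv.

End UTerms.

Section UAlgebra.
Variables (k : fieldType) (p : nat) (hp : p \in [pchar k]).

(* hp is a parameter because u^p = 0 collapses U for p = 0, and because the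
   comultiplication exists only in characteristic p. *)
Definition U : Type := let _ := hp in {eq_quot (@ueqb k p)}.
HB.instance Definition _ := Choice.copy U {eq_quot (@ueqb k p)}.

Definition uclass (x : uterm k) : U := \pi_({eq_quot (@ueqb k p)}) x.
Definition urepr (x : U) : uterm k := repr (x : {eq_quot (@ueqb k p)}).

Lemma ureprK x : uclass (urepr x) = x.
Proof. exact: reprK. Qed.

Lemma uclassP x y : uclass x = uclass y <-> ueq p x y.
Proof.
split=> [/eqmodP/asboolP //|xy]; exact/eqmodP/asboolP.
Qed.

Lemma urepr_class x : ueq p (urepr (uclass x)) x.
Proof. by apply/uclassP; rewrite ureprK. Qed.

Lemma uclassK (P : U -> Prop) : (forall x, P (uclass x)) -> forall x, P x.
Proof. by move=> h x; rewrite -[x]ureprK. Qed.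

Definition uconst (c : k) : U := uclass (EConst c).
Definition uadd x y := uclass (EAdd (urepr x) (urepr y)).
Definition umul x y := uclass (EMul (urepr x) (urepr y)).
Definition uopp x := umul (uconst (-1)) x.

Lemma uaddE x y : uadd (uclass x) (uclass y) = uclass (EAdd x y).
Proof. by apply/uclassP/ueq_add; apply: urepr_class. Qed.

Lemma umulE x y : umul (uclass x) (uclass y) = uclass (EMul x y).
Proof. by apply/uclassP/ueq_mul; apply: urepr_class. Qed.

Fact uaddA : associative uadd.
Proof.
elim/uclassK=> x; elim/uclassK=> y; elim/uclassK=> z.
by rewrite !uaddE; apply/uclassP/ueq_addA.
Qed.

Fact uaddC : commutative uadd.
Proof.
elim/uclassK=> x; elim/uclassK=> y.
by rewrite !uaddE; apply/uclassP/ueq_addC.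
Qed.

Fact uadd0 : left_id (uconst 0) uadd.
Proof. by elim/uclassK=> x; rewrite uaddE; apply/uclassP/ueq_add0. Qed.

Fact uaddN : left_inverse (uconst 0) uopp uadd.
Proof.
by elim/uclassK=> x; rewrite /uopp umulE uaddE; apply/uclassP/ueq_addN.
Qed.

HB.instance Definition _ := GRing.isZmodule.Build U uaddA uaddC uadd0 uaddN.

Fact umulA : associative umul.
Proof.
elim/uclassK=> x; elim/uclassK=> y; elim/uclassK=> z.
by rewrite !umulE; apply/uclassP/ueq_mulA.
Qed.

Fact umul1l : left_id (uconst 1) umul.
Proof. by elim/uclassK=> x; rewrite umulE; apply/uclassP/ueq_mul1l. Qed.

Fact umul1r : right_id (uconst 1) umul.
Proof. by elim/uclassK=> x; rewrite umulE; apply/uclassP/ueq_mul1r. Qed.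

Fact umulDl : left_distributive umul +%R.
Proof.
elim/uclassK=> x; elim/uclassK=> y; elim/uclassK=> z.
rewrite -[_ + _]/(uadd _ _) -[RHS]/(uadd _ _) !(uaddE, umulE).
exact/uclassP/ueq_mulDl.
Qed.

Fact umulDr : right_distributive umul +%R.
Proof.
elim/uclassK=> x; elim/uclassK=> y; elim/uclassK=> z.
rewrite -[_ + _]/(uadd _ _) -[RHS]/(uadd _ _) !(uaddE, umulE).
exact/uclassP/ueq_mulDr.
Qed.

HB.instance Definition _ := GRing.Zmodule_isPzRing.Build U
  umulA umul1l umul1r umulDl umulDr.

Fact uconst_nmod : nmod_morphism uconst.
Proof.
split=> // a b.
by rewrite -[RHS]/(uadd _ _) uaddE; apply/uclassP/ueq_constD.
Qed.

Fact uconst_monoid : monoid_morphism uconst.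
Proof.
split=> // a b.
by rewrite -[RHS]/(umul _ _) umulE; apply/uclassP/ueq_constM.
Qed.

HB.instance Definition _ := GRing.isNmodMorphism.Build k U uconst uconst_nmod.
HB.instance Definition _ :=
  GRing.isMonoidMorphism.Build k U uconst uconst_monoid.

Lemma uconst_central c x : uconst c * x = x * uconst c.
Proof.
elim/uclassK: x => x; rewrite -[LHS]/(umul _ _) -[RHS]/(umul _ _) !umulE.
exact/uclassP/ueq_constC.
Qed.

Definition gen_u : U := uclass (Eu k).
Definition gen_w : U := uclass (Ew k).

Lemma uclass_pow x n : uclass (EPow x n) = uclass x ^+ n.
Proof.
elim: n => [//|n IHn]; rewrite exprS -IHn.
by rewrite -[RHS]/(umul _ _) umulE.
Qed.

Lemma gen_u_p : gen_u ^+ p = 0.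
Proof. by rewrite -uclass_pow; apply/uclassP/ueq_up. Qed.

Lemma gen_w_p : gen_w ^+ p = gen_w.
Proof. by rewrite -uclass_pow; apply/uclassP/ueq_wp. Qed.

Lemma gen_wu : gen_w * gen_u - gen_u * gen_w = gen_u.
Proof.
rewrite -[LHS]/(uadd (umul _ _) (uopp (umul _ _))) /uopp /uconst.
rewrite /gen_u /gen_w !umulE uaddE.
exact/uclassP/ueq_wu.
Qed.

Lemma U_ind (P : U -> Prop) :
  P gen_u -> P gen_w -> (forall c, P (uconst c)) ->
  (forall x y, P x -> P y -> P (x + y)) ->
  (forall x y, P x -> P y -> P (x * y)) -> forall x, P x.
Proof.
move=> Pu Pw Pc Pa Pm; elim/uclassK; elim=> [//|//|c|x Px y Py|x Px y Py].
- exact: Pc.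
- by rewrite -uaddE; apply: Pa.
- by rewrite -umulE; apply: Pm.
Qed.

(* The k-algebra B is a ring with a central ring morphism iota : k -> B, so that
   the (possibly trivial) rings 'M_n and A (x) B are covered. *)
Section Lift.
Variables (B : pzRingType) (iota : {rmorphism k -> B}) (a b : B).

Fixpoint ueval (x : uterm k) : B :=
  match x with
  | Eu => a
  | Ew => b
  | EConst c => iota c
  | EAdd x y => ueval x + ueval y
  | EMul x y => ueval x * ueval y
  end.

(* The algebra morphism U -> B with u |-> a and w |-> b, meaningful when
   iota is central and a, b satisfy the defining relations of U. *)
Definition ulift (x : U) : B := ueval (urepr x).

Hypothesis iotaC : forall c x, GRing.comm (iota c) x.
Hypotheses (a_p : a ^+ p = 0) (b_p : b ^+ p = b) (ba : b * a - a * b = a).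

Lemma ueval_pow x n : ueval (EPow x n) = ueval x ^+ n.
Proof. by elim: n => [|n /= ->]; rewrite ?exprS //= rmorph1. Qed.

Lemma ueval_eq x y : ueq p x y -> ueval x = ueval y.
Proof.
elim=> {x y} //=.
- by move=> x y z _ -> _ ->.
- by move=> x x' y y' _ -> _ ->.
- by move=> x x' y y' _ -> _ ->.
- by move=> *; rewrite addrA.
- by move=> *; rewrite addrC.
- by move=> *; rewrite rmorph0 add0r.
- by move=> *; rewrite rmorphN1 rmorph0 mulN1r addNr.
- by move=> *; rewrite mulrA.
- by move=> *; rewrite rmorph1 mul1r.
- by move=> *; rewrite rmorph1 mulr1.
- by move=> *; rewrite mulrDl.
- by move=> *; rewrite mulrDr.
- by move=> *; rewrite rmorphD.
- by move=> *; rewrite rmorphM.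
- by move=> c x; apply: iotaC.
- by rewrite ueval_pow rmorph0.
- by rewrite ueval_pow.
- by rewrite rmorphN1 mulN1r.
Qed.

Lemma ulift_class x : ulift (uclass x) = ueval x.
Proof. exact/ueval_eq/urepr_class. Qed.

Lemma ulift_u : ulift gen_u = a.
Proof. exact: ulift_class. Qed.

Lemma ulift_w : ulift gen_w = b.
Proof. exact: ulift_class. Qed.

Lemma ulift_const c : ulift (uconst c) = iota c.
Proof. exact: ulift_class. Qed.

Lemma uliftD x y : ulift (x + y) = ulift x + ulift y.
Proof.
elim/uclassK: x => x; elim/uclassK: y => y.
by rewrite -[_ + _]/(uadd _ _) uaddE !ulift_class.
Qed.

Lemma uliftM x y : ulift (x * y) = ulift x * ulift y.
Proof.
elim/uclassK: x => x; elim/uclassK: y => y.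
by rewrite -[_ * _]/(umul _ _) umulE !ulift_class.
Qed.

Lemma ulift1 : ulift 1 = 1.
Proof. by rewrite -[1]/(uconst 1) ulift_const rmorph1. Qed.

End Lift.

Let p_gt0 : (0 < p)%N.
Proof. exact/prime_gt0/(pcharf_prime hp). Qed.

Fact U_oner_neq0 : (1 : U) != 0.
Proof.
have z : (0 : k) ^+ p = 0 by rewrite expr0n gtn_eqF.
have z' : (0 : k) * 0 - 0 * 0 = 0 by rewrite mul0r subr0.
have idC (c x : k) : GRing.comm (idfun c) x by apply: mulrC.
apply/eqP => eq10.
have : ulift idfun (0 : k) 0 (uconst 1) = ulift idfun 0 0 (uconst 0).
  exact: congr1 eq10.
rewrite !(ulift_const idC z z z') /=.
by apply/eqP; rewrite oner_eq0.
Qed.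

HB.instance Definition _ := GRing.PzSemiRing_isNonZero.Build U U_oner_neq0.

Definition uscale (c : k) (x : U) : U := uconst c * x.

Fact uscaleA a b x : uscale a (uscale b x) = uscale (a * b) x.
Proof. by rewrite /uscale rmorphM mulrA. Qed.

Fact uscale1 : left_id 1 uscale.
Proof. by move=> x; rewrite /uscale rmorph1 mul1r. Qed.

Fact uscaleDr : right_distributive uscale +%R.
Proof. by move=> c x y; rewrite /uscale mulrDr. Qed.

Fact uscaleDl x : {morph uscale^~ x : a b / a + b}.
Proof. by move=> a b; rewrite /uscale rmorphD mulrDl. Qed.

HB.instance Definition _ := GRing.Zmodule_isLmodule.Build k U
  uscaleA uscale1 uscaleDr uscaleDl.

Fact uscaleAl (c : k) (x y : U) : c *: (x * y) = (c *: x) * y.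
Proof. by rewrite -[LHS]/(uconst c * _) mulrA. Qed.

Fact uscaleAr (c : k) (x y : U) : c *: (x * y) = x * (c *: y).
Proof. by rewrite -[LHS]/(uconst c * _) mulrA uconst_central -mulrA. Qed.

HB.instance Definition _ := GRing.Lmodule_isLalgebra.Build k U uscaleAl.
HB.instance Definition _ := GRing.Lalgebra_isAlgebra.Build k U uscaleAr.

(* Comultiplication; u and w are primitive. *)

Local Notation UU := (tensor_alg U U).
Definition cop_u : UU := (tpure gen_u 1 : UU) + (tpure 1 gen_u : UU).
Definition cop_w : UU := (tpure gen_w 1 : UU) + (tpure 1 gen_w : UU).

Definition cop : U -> UU := ulift (@tconst k U U) cop_u cop_w.

Lemma tpow_pure (a b : U) n :
  (tpure a b : UU) ^+ n = tpure (a ^+ n) (b ^+ n).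
Proof. by elim: n => [//|n IHn]; rewrite !exprS IHn tmul_pure. Qed.

Lemma tensor_exprDp (x y : UU) : GRing.comm x y ->
  (x + y) ^+ p = x ^+ p + y ^+ p.
Proof.
move=> cxy; have defp := prednK p_gt0.
rewrite exprDn_comm // big_ord_recr subnn -defp big_ord_recl /= defp.
rewrite subn0 mulr1 mul1r bin0 binn big1 ?addr0 // => i _.
rewrite -scaler_nat (_ : _%:R = 0) ?scale0r //; apply/eqP.
rewrite -(dvdn_pcharf hp) prime_dvd_bin ?(pcharf_prime hp) //.
by rewrite /bump /= add1n -[X in (_ < X)%N]defp ltnS ltn_ord.
Qed.

Lemma cop_u_p : cop_u ^+ p = 0.
Proof.
have tB := @tpure_bilinear k U U.
rewrite tensor_exprDp ?tpow_pure ?gen_u_p.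
  by rewrite !expr1n (bilinear0l _ tB) (bilinear0r _ tB) addr0.
by rewrite /GRing.comm !tmul_pure !mul1r !mulr1.
Qed.

Lemma cop_w_p : cop_w ^+ p = cop_w.
Proof.
rewrite tensor_exprDp ?tpow_pure ?gen_w_p ?expr1n //.
by rewrite /GRing.comm !tmul_pure !mul1r !mulr1.
Qed.

Lemma cop_wu : cop_w * cop_u - cop_u * cop_w = cop_u.
Proof.
have wu : gen_w * gen_u = gen_u * gen_w + gen_u.
  by apply/eqP; rewrite addrC -subr_eq gen_wu.
rewrite /cop_w /cop_u !mulrDl !mulrDr !tmul_pure !mul1r !mulr1 wu.
rewrite tpureDl tpureDr; apply/eqP; rewrite subr_eq; apply/eqP.
rewrite -!addrA [LHS]addrCA; congr (_ + _).
rewrite [RHS]addrCA; congr (_ + _).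
rewrite [LHS]addrCA [RHS]addrCA; congr (_ + _).
by rewrite addrA addrC.
Qed.

Lemma copM x y : cop (x * y) = cop x * cop y.
Proof. exact: (uliftM (@tconst_central _ _ _) cop_u_p cop_w_p cop_wu). Qed.

Lemma copD x y : cop (x + y) = cop x + cop y.
Proof. exact: (uliftD (@tconst_central _ _ _) cop_u_p cop_w_p cop_wu). Qed.

Lemma cop1 : cop 1 = 1.
Proof. exact: (ulift1 (@tconst_central _ _ _) cop_u_p cop_w_p cop_wu). Qed.

Lemma cop_gen_u : cop gen_u = cop_u.
Proof. exact: (ulift_u (@tconst_central _ _ _) cop_u_p cop_w_p cop_wu). Qed.

Lemma cop_gen_w : cop gen_w = cop_w.
Proof. exact: (ulift_w (@tconst_central _ _ _) cop_u_p cop_w_p cop_wu). Qed.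

Lemma cop_const c : cop (uconst c) = tconst U U c.
Proof. exact: (ulift_const (@tconst_central _ _ _) cop_u_p cop_w_p cop_wu). Qed.

End UAlgebra.

(* Restriction of scalars along k -> A, c |-> c%:A. *)

Section Restriction.
Variables (k : fieldType) (A : algType k) (V : lmodType A).

Definition restr : Type := V.
HB.instance Definition _ := GRing.Zmodule.on restr.

Definition rscale (c : k) (v : restr) : restr := (c%:A : A) *: (v : V).

Fact rscaleA a b x : rscale a (rscale b x) = rscale (a * b) x.
Proof. by rewrite /rscale scalerA -scalerAl mul1r scalerA. Qed.

Fact rscale1 : left_id 1 rscale.
Proof. by move=> x; rewrite /rscale !scale1r. Qed.

Fact rscaleDr : right_distributive rscale +%R.
Proof. by move=> c x y; rewrite /rscale scalerDr. Qed.

Fact rscaleDl x : {morph rscale^~ x : a b / a + b}.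
Proof. by move=> a b; rewrite /rscale !scalerDl. Qed.

HB.instance Definition _ := GRing.Zmodule_isLmodule.Build k restr
  rscaleA rscale1 rscaleDr rscaleDl.

Definition ract (a : A) (v : restr) : restr := a *: (v : V).

Lemma ract_bilinear : bilinear_fun ract.
Proof.
split=> [a a' v|a v v'|c a v|c a v].
- exact: (@scalerDl A V v a a').
- exact: (@scalerDr A V a v v').
- by rewrite -[RHS]/(_ *: (_ *: _)) scalerA -scalerAl mul1r.
- by rewrite -[RHS]/(_ *: (_ *: _)) /ract -[c *: v]/(_ *: _) !scalerA
     -scalerAl -scalerAr mul1r mulr1.
Qed.

End Restriction.

Section ModuleTensor.
Variables (k : fieldType) (p : nat) (hp : p \in [pchar k]).
Variables V W : lmodType (U hp).

Definition mtensor : Type := tensor (restr V) (restr W).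
HB.instance Definition _ := GRing.Zmodule.on mtensor.

Definition mtscale (h : U hp) (x : mtensor) : mtensor :=
  tact (@ract _ _ V) (@ract _ _ W) (cop h) x.

Let aV := @ract_bilinear k (U hp) V.
Let aW := @ract_bilinear k (U hp) W.

Fact mtscaleA a b x : mtscale a (mtscale b x) = mtscale (a * b) x.
Proof.
rewrite /mtscale copM -tactM // => *; by rewrite /ract scalerA.
Qed.

Fact mtscale1 : left_id 1 mtscale.
Proof.
have tB := tact_bilinear aV aW; have [_ Dr _ Zr] := tB.
move=> x; rewrite /mtscale cop1.
elim/tensor_ind: x => [|v w|x y hx hy|c x hx].
- exact: bilinear0r.
- by rewrite tact_pure // /ract !scale1r.
- by rewrite Dr hx hy.
- by rewrite Zr hx.
Qed.

Fact mtscaleDr : right_distributive mtscale +%R.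
Proof. by move=> h x y; have [_ D _ _] := tact_bilinear aV aW; apply: D. Qed.

Fact mtscaleDl x : {morph mtscale^~ x : a b / a + b}.
Proof.
by move=> a b; rewrite /mtscale copD; have [D _ _ _] := tact_bilinear aV aW;
   apply: D.
Qed.

HB.instance Definition _ := GRing.Zmodule_isLmodule.Build (U hp) mtensor
  mtscaleA mtscale1 mtscaleDr mtscaleDl.

Lemma mtensor_u (v : V) (w : W) :
  gen_u hp *: (tpure (v : restr V) (w : restr W) : mtensor)
  = (tpure (gen_u hp *: v : restr V) (w : restr W) : mtensor)
    + (tpure (v : restr V) (gen_u hp *: w : restr W) : mtensor).
Proof.
have [D _ _ _] := tact_bilinear aV aW.
rewrite -[LHS]/(mtscale _ _) /mtscale cop_gen_u D !tact_pure //.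
by rewrite /ract !scale1r.
Qed.

Lemma mtensor_w (v : V) (w : W) :
  gen_w hp *: (tpure (v : restr V) (w : restr W) : mtensor)
  = (tpure (gen_w hp *: v : restr V) (w : restr W) : mtensor)
    + (tpure (v : restr V) (gen_w hp *: w : restr W) : mtensor).
Proof.
have [D _ _ _] := tact_bilinear aV aW.
rewrite -[LHS]/(mtscale _ _) /mtscale cop_gen_w D !tact_pure //.
by rewrite /ract !scale1r.
Qed.

End ModuleTensor.

(* Direct sum of a finite family of modules (the zero module when n = 0). *)

Section DirectSum.
Variables (R : pzRingType) (n : nat) (V : 'I_n -> lmodType R).

Definition dsum : Type := {dffun forall i : 'I_n, V i}.
HB.instance Definition _ := Choice.on dsum.

Definition dsum0 : dsum := [ffun i => 0 : V i].
Definition dsum_opp (f : dsum) : dsum := [ffun i => - f i : V i].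
Definition dsum_add (f g : dsum) : dsum := [ffun i => f i + g i : V i].
Definition dsum_scale (a : R) (f : dsum) : dsum := [ffun i => a *: f i : V i].

Fact dsum_addA : associative dsum_add.
Proof. by move=> f g h; apply/ffunP=> i; rewrite !ffunE addrA. Qed.

Fact dsum_addC : commutative dsum_add.
Proof. by move=> f g; apply/ffunP=> i; rewrite !ffunE addrC. Qed.

Fact dsum_add0 : left_id dsum0 dsum_add.
Proof. by move=> f; apply/ffunP=> i; rewrite !ffunE add0r. Qed.

Fact dsum_addN : left_inverse dsum0 dsum_opp dsum_add.
Proof. by move=> f; apply/ffunP=> i; rewrite !ffunE addNr. Qed.

HB.instance Definition _ := GRing.isZmodule.Build dsum
  dsum_addA dsum_addC dsum_add0 dsum_addN.

Fact dsum_scaleA a b f :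
  dsum_scale a (dsum_scale b f) = dsum_scale (a * b) f.
Proof. by apply/ffunP=> i; rewrite !ffunE scalerA. Qed.

Fact dsum_scale1 : left_id 1 dsum_scale.
Proof. by move=> f; apply/ffunP=> i; rewrite !ffunE scale1r. Qed.

Fact dsum_scaleDr : right_distributive dsum_scale +%R.
Proof. by move=> a f g; apply/ffunP=> i; rewrite !ffunE scalerDr. Qed.

Fact dsum_scaleDl f : {morph dsum_scale^~ f : a b / a + b}.
Proof. by move=> a b; apply/ffunP=> i; rewrite !ffunE scalerDl. Qed.

HB.instance Definition _ := GRing.Zmodule_isLmodule.Build R dsum
  dsum_scaleA dsum_scale1 dsum_scaleDr dsum_scaleDl.

End DirectSum.

Definition mod_iso (R : pzRingType) (V W : lmodType R) : Prop :=
  exists f : {linear V -> W}, bijective f.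

(* The module M(l,i). Its elements are the coordinate columns with respect to
   the standard basis, x_j being delta_mx j 0 with j counted from 0, so that
   w x_j = (i + j) x_j. *)

Section StandardModule.
Variables (k : fieldType) (p : nat) (hp : p \in [pchar k]).
Variables (l : nat) (i : 'F_p).

(* M(l,i) is only defined for l <= p: u^p would not act as 0 otherwise. To have
   a total definition, u acts as 0 in the irrelevant case l > p. *)
Definition Mu : 'M[k]_l :=
  if (l <= p)%N then \matrix_(a, b) (a == b.+1 :> nat)%:R else 0.

Definition Mw : 'M[k]_l := diag_mx (\row_j (i + j)%N%:R).

Lemma Mu_p : Mu ^+ p = 0.
Proof.
rewrite /Mu; case: leqP => [le_lp|_]; last first.
  by rewrite expr0n gtn_eqF // prime_gt0 // (pcharf_prime hp).
set N := \matrix_(_, _) _.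
suff Npow n : N ^+ n = \matrix_(a, b) (a == b + n :> nat)%N%:R.
  apply/matrixP=> a b; rewrite Npow !mxE.
  by rewrite ltn_eqF // (leq_trans (ltn_ord a)) // (leq_trans le_lp) ?leq_addl.
elim: n => [|n IHn].
  by apply/matrixP=> a b; rewrite expr0 !mxE addn0.
rewrite exprS IHn; apply/matrixP=> a b; rewrite -[_ * _]/(_ *m _) !mxE.
case: (ltnP (b + n) l) => [lt_bn|ge_bn].
  rewrite (bigD1 (Ordinal lt_bn)) //= !mxE eqxx mulr1 addnS big1 ?addr0 //.
  by move=> c ne; rewrite !mxE -[c == _ :> nat]/(c == Ordinal lt_bn)
     (negPf ne) mulr0.
rewrite big1 => [|c _].
  by rewrite ltn_eqF // addnS ltnS (leq_trans (ltnW (ltn_ord a))).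
by rewrite !mxE [_ == _ + _ :> nat]ltn_eqF ?mulr0 // (leq_trans (ltn_ord c)).
Qed.

Lemma Mw_p : Mw ^+ p = Mw.
Proof.
have pow n : Mw ^+ n = diag_mx (\row_j (i + j)%N%:R ^+ n).
  elim: n => [|n IHn].
    by rewrite expr0; apply/matrixP=> a b; rewrite !mxE.
  rewrite exprS IHn /Mw -[_ * _]/(_ *m _) mulmx_diag.
  by congr diag_mx; apply/rowP=> j; rewrite !mxE exprS.
rewrite pow; congr diag_mx; apply/rowP=> j; rewrite !mxE.
by rewrite -(pFrobenius_autE hp) pFrobenius_aut_nat.
Qed.

Lemma Mwu : Mw * Mu - Mu * Mw = Mu.
Proof.
rewrite /Mu; case: leqP => _; last by rewrite mulr0 mul0r subr0.
apply/matrixP=> a b; rewrite -!/(_ *m _) /Mw.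
rewrite -[_ * _]/(_ *m _) -[X in _ - X]/(_ *m _) mul_diag_mx mul_mx_diag !mxE.
case: eqP => [->|_]; last by rewrite mulr0 mul0r subr0.
by rewrite mulr1 mul1r addnS -addn1 natrD addrC addKr.
Qed.

Definition Mrep : U hp -> 'M[k]_l := ulift (@scalar_mx k l) Mu Mw.

Let scalarC (c : k) (A : 'M[k]_l) : GRing.comm (c%:M) A.
Proof. exact: comm_scalar_mx. Qed.

Definition M : Type := let _ := hp in let _ := i in 'cV[k]_l.
HB.instance Definition _ := GRing.Zmodule.copy M 'cV[k]_l.

Definition Mscale (h : U hp) (v : M) : M := Mrep h *m (v : 'cV[k]_l).

Fact MscaleA a b v : Mscale a (Mscale b v) = Mscale (a * b) v.
Proof.
by rewrite /Mscale mulmxA /Mrep (uliftM scalarC Mu_p Mw_p Mwu).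
Qed.

Fact Mscale1 : left_id 1 Mscale.
Proof.
by move=> v; rewrite /Mscale /Mrep (ulift1 hp scalarC Mu_p Mw_p Mwu) mul1mx.
Qed.

Fact MscaleDr : right_distributive Mscale +%R.
Proof. by move=> h v w; apply: mulmxDr. Qed.

Fact MscaleDl v : {morph Mscale^~ v : a b / a + b}.
Proof.
move=> a b; rewrite /Mscale /Mrep (uliftD scalarC Mu_p Mw_p Mwu).
exact: mulmxDl.
Qed.

HB.instance Definition _ := GRing.Zmodule_isLmodule.Build (U hp) M
  MscaleA Mscale1 MscaleDr MscaleDl.

Definition Mbasis (j : 'I_l) : M := delta_mx j 0 : 'cV[k]_l.

Lemma M_u (v : M) : gen_u hp *: v = Mu *m (v : 'cV[k]_l).
Proof.
by rewrite -[LHS]/(Mscale _ _) /Mscale /Mrep (ulift_u hp scalarC Mu_p Mw_p Mwu).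
Qed.

Lemma M_w (v : M) : gen_w hp *: v = Mw *m (v : 'cV[k]_l).
Proof.
by rewrite -[LHS]/(Mscale _ _) /Mscale /Mrep (ulift_w hp scalarC Mu_p Mw_p Mwu).
Qed.

Lemma M_scalar (c : k) (v : M) : (c%:A : U hp) *: v = c *: (v : 'cV[k]_l).
Proof.
rewrite -[LHS]/(Mscale _ _) /Mscale /Mrep -[c%:A]/(uconst hp c * 1) mulr1.
by rewrite (ulift_const hp scalarC Mu_p Mw_p Mwu) mul_scalar_mx.
Qed.

Lemma M_w_basis j :
  gen_w hp *: Mbasis j = ((i + j)%N%:R%:A : U hp) *: Mbasis j.
Proof.
rewrite M_w M_scalar; apply/matrixP=> a b.
rewrite mul_diag_mx !mxE; case: (a =P j) => [->|_] //.
by rewrite !mulr0.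
Qed.

Lemma M_u_basis (j j' : 'I_l) : (l <= p)%N -> j' = j.+1 :> nat ->
  gen_u hp *: Mbasis j = Mbasis j'.
Proof.
move=> le_lp Ej; rewrite M_u /Mu le_lp; apply/matrixP=> a b.
rewrite -[Mbasis j]/(delta_mx j 0) -colE !mxE.
by rewrite ord1 eqxx andbT -Ej.
Qed.

Lemma M_u_last (j : 'I_l) : j.+1 = l -> gen_u hp *: Mbasis j = 0.
Proof.
move=> Ej; rewrite M_u /Mu; case: leqP => _; last by rewrite mul0mx.
apply/matrixP=> a b; rewrite -colE !mxE ltn_eqF //.
by rewrite Ej ltn_ord.
Qed.

End StandardModule.

(* Main.v *)
From HB Require Import structures.
Require Import Defs.
From mathcomp Require Import all_boot all_order all_algebra.
From mathcomp Require Import zify ring.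

Set Implicit Arguments.
Unset Strict Implicit.
Unset Printing Implicit Defensive.

Import GRing.Theory.
Local Open Scope ring_scope.

(** Send x_(a+1) of M(l,r) to x^a and x_(b+1) of M(m,r') to y^b. The tensor
    product becomes A = k[x,y]/(x^l, y^m), on which u is the multiplication E by
    x + y and w multiplies a homogeneous polynomial of degree D by r + r' + D. A
    summand M(n, r + r' + d) is the same thing as a string v, E v, ..., E^(n-1) v with v
    homogeneous of degree d and E^n v = 0, so A has to be cut into strings.

    Strings whose last vectors E^(n-1) v are nonzero and lie in pairwise
    different degrees are jointly independent: applying a power of E to a
    linear relation leaves only last vectors, and these cannot cancel
    ([string_free]). If moreover the lengths add up to l m = dim A, they form a
    basis ([string_span]). So it suffices to find strings of the right degrees
    and lengths.

    - Short strings. Let F be the operator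
      x^a y^b |-> a(l-a) x^(a-1) y^b + b(m-b) x^a y^(b-1), the other half of an
      sl2 action. On a vector v of degree d < l with F v = 0
      ([primitive_vector]) one has F E^(j+1) v = (j+1)(N-j) E^j v, where
      N = l + m - 2 - 2d ([lower_iter_raise]). If N < p, the scalars are nonzero
      for j < N, hence E^N v is nonzero ([iter_raise_neq0]). For j = N the
      scalar is 0; as E^(N+1) v has degree l + m - 1 - d >= m >= l and F is
      injective in degrees at least l ([lower_inj]), E^(N+1) v = 0
      ([iter_raise_top]). The length is n = N + 1, and the last
      vector has degree l + m - 2 - d.
    - Long strings, when l + m > p. For d < l + m - p take v = y^d. The binomial
      theorem gives E^p v = (x^p + y^p) y^d = 0, while E^(p-1) v contains the
      monomial x^(l-1) y^(d+p-l) with coefficient C(p-1, l-1), which is nonzero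
      in k ([iter_raise_y_power_p], [iter_raise_y_power_neq0]). The last vector
      has degree d + p - 1.

    If l + m <= p, the short strings with 0 <= d < l do. If l + m > p, the short
    strings with l + m - p <= d < l have last vectors in degrees m - 1, ...,
    p - 2, and the long ones in degrees p - 1, ..., l + m - 2.

    Both sides of the isomorphism are compared with A, encoded as the space of
    l x m matrices of coefficients; since U is generated by u, w and k, a
    bijection commuting with these is U-linear ([realizes_mod_iso]). *)

(** * Integers in characteristic p *)

Section CharP.
Variables (k : fieldType) (p : nat) (hp : p \in [pchar k]).

Lemma natr_neq0 n : (0 < n < p)%N -> n%:R != 0 :> k.
Proof.
case/andP=> n_gt0 lt_np; rewrite -(dvdn_pcharf hp).
by apply/negP => /(dvdn_leq n_gt0); rewrite leqNgt lt_np.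
Qed.

(** C(p-1, j) divides (p-1)!, which is -1 modulo p by Wilson's theorem. *)
Lemma bin_pred_neq0 j : (j < p)%N -> 'C(p.-1, j)%:R != 0 :> k.
Proof.
move=> lt_jp; have p_pr := pcharf_prime hp.
have le_jp : (j <= p.-1)%N by lia.
rewrite -(dvdn_pcharf hp); apply/negP => p_dvd.
have p_dvdf : (p %| (p.-1)`!)%N by rewrite -(bin_fact le_jp) dvdn_mulr.
move: (p_pr); rewrite (Wilson (prime_gt1 p_pr)) -addn1 dvdn_addr // dvdn1.
by move/eqP=> p1; move: p_pr; rewrite p1.
Qed.

(** The weights i + j of M(l,i) are formed with the representative of i in
    [0, p-1]; in k this choice disappears. *)
Lemma Fp_natr (n : nat) : ((n%:R : 'F_p) : nat)%:R = n%:R :> k.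
Proof.
rewrite val_Fp_nat; last exact: pcharf_prime hp.
by rewrite {2}(divn_eq n p) natrD natrM (pcharf0 hp) mulr0 add0r.
Qed.

Lemma Fp_natrD (x y : 'F_p) : ((x + y)%R : nat)%:R = x%:R + y%:R :> k.
Proof.
have -> : x + y = (x + y)%N%:R :> 'F_p by rewrite natrD !natr_Zp.
by rewrite Fp_natr natrD.
Qed.

End CharP.

(** * Matrices as truncated polynomials in two variables *)

Lemma sum_ord_pick (R : pzRingType) (n x : nat) (g : nat -> R) :
  \sum_(c < n) (x == c)%:R * g c = if (x < n)%N then g x else 0.
Proof.
case: ltnP => [lt_xn|le_nx].
  rewrite (bigD1 (Ordinal lt_xn)) //= eqxx mul1r big1 ?addr0 // => c.
  by rewrite -val_eqE eq_sym /= => /negPf ->; rewrite mul0r.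
by rewrite big1 // => c _; rewrite gtn_eqF ?mul0r // (leq_trans (ltn_ord c)).
Qed.

Lemma sum_ord_pred (R : pzRingType) (n x : nat) (g : nat -> R) : (x <= n)%N ->
  \sum_(c < n) (x == c.+1)%:R * g c = (0 < x)%N%:R * g x.-1.
Proof.
case: x => [|x] le_xn; first by rewrite mul0r big1 // => c _; rewrite mul0r.
by under eq_bigr do rewrite eqSS; rewrite sum_ord_pick le_xn mul1r.
Qed.

Section Kronecker.
Variables (k : fieldType) (l m : nat).
Implicit Types X : 'M[k]_(l, m).

(** The operator A (x) 1 + 1 (x) B, the form in which primitive elements act on
    a tensor product, when the tensor e_a (x) e_b is the elementary matrix at
    (a, b). *)
Definition ksum (A : 'M[k]_l) (B : 'M[k]_m) X : 'M[k]_(l, m) :=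
  A *m X + X *m B^T.

Fact ksum_is_linear A B : linear (ksum A B).
Proof.
move=> c X Y; rewrite /ksum mulmxDr mulmxDl -scalemxAr -scalemxAl scalerDr.
by rewrite addrACA.
Qed.
HB.instance Definition _ A B :=
  GRing.isLinear.Build k 'M[k]_(l, m) 'M[k]_(l, m) _ (ksum A B)
    (ksum_is_linear A B).

Lemma ksum_commutator A A' B B' X :
  ksum A B (ksum A' B' X) - ksum A' B' (ksum A B X)
  = ksum (A *m A' - A' *m A) (B *m B' - B' *m B) X.
Proof.
rewrite /ksum mulmxBl [(_ - _)^T]linearB /= mulmxBr !mulmxDr !mulmxDl.
rewrite !trmx_mul !mulmxA.
set a := A *m A' *m X; set b := A' *m X *m B^T; set c := A *m X *m B'^T.
set d := X *m B'^T *m B^T; set e := A' *m A *m X; set f := X *m B^T *m B'^T.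
rewrite [b + d]addrC [c + f]addrC [a + c + _]addrACA [e + b + _]addrACA.
by rewrite [b + c]addrC opprD [LHS]addrACA subrr addr0 opprD addrACA.
Qed.

Definition homog (d : nat) X :=
  forall (a : 'I_l) (b : 'I_m), (a + b)%N <> d -> X a b = 0.

End Kronecker.

(** * Strings of a nilpotent operator *)

Lemma tagged_ord_inj (I : Type) (n : I -> nat) (t t' : {i : I & 'I_(n i)}) :
  tag t = tag t' -> tagged t = tagged t' :> nat -> t = t'.
Proof.
case: t t' => i j [i' j'] /= ii; case: i' / ii j' => j' jj.
by congr existT; apply: val_inj.
Qed.

Definition string_map (k : fieldType) (Z : lmodType k) (e : {linear Z -> Z}) n
    (v : Z) (x : 'cV[k]_n) : Z :=
  \sum_(j < n) x j 0 *: iter j e v.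

Section Strings.
Variables (k : fieldType) (l m : nat).
Variable e : {linear 'M[k]_(l, m) -> 'M[k]_(l, m)}.
Hypothesis e_homog : forall d X, homog d X -> homog d.+1 (e X).
Implicit Types X v : 'M[k]_(l, m).

Lemma iter_linear_sum (T : finType) (c : T -> k) (x : T -> 'M[k]_(l, m)) n :
  iter n e (\sum_t c t *: x t) = \sum_t c t *: iter n e (x t).
Proof.
elim: n => [//|n /= ->]; rewrite linear_sum; apply: eq_bigr => t _.
exact: linearZ.
Qed.

Lemma iter_homog d X n : homog d X -> homog (d + n) (iter n e X).
Proof.
by move=> dX; elim: n => [|n IHn] /=; rewrite ?addn0 // addnS; apply: e_homog.
Qed.

Lemma iter_eq0 n n' X : (n <= n')%N -> iter n e X = 0 -> iter n' e X = 0.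
Proof.
move=> /subnK <- X0; rewrite iterD X0.
by elim: (n' - n)%N => //= i ->; rewrite linear0.
Qed.

Variables (I : finType) (v : I -> 'M[k]_(l, m)) (n d : I -> nat).
Hypothesis v_homog : forall i, homog (d i) (v i).
Hypothesis v_nil : forall i, iter (n i) e (v i) = 0.
Hypothesis v_socle : forall i, iter (n i).-1 e (v i) <> 0.
Hypothesis socle_inj : injective (fun i => d i + n i)%N.

Local Notation T := {i : I & 'I_(n i)}.

(** In a relation, pick a term t with nonzero coefficient and as far as possible
    from the end of its string, and apply the power q of e that moves t to the
    end of its string. The other terms either die or also become last vectors,
    in degrees different from that of t; so a nonzero entry of the last vector
    of t is not cancelled. *)
Lemma string_free (c : T -> k) :
  \sum_t c t *: iter (tagged t) e (v (tag t)) = 0 -> forall t, c t = 0.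
Proof.
move=> c0 t0; apply/eqP; apply: contraT => ct0.
pose ht (t : T) := (n (tag t) - tagged t)%N.
case: (@arg_maxnP T t0 (fun t => c t != 0) ht ct0) => t ct t_max.
pose q := (n (tag t) - (tagged t).+1)%N.
have /(congr1 (iter q e)) := c0; rewrite iter_linear_sum.
have -> : iter q e 0 = 0 by elim: q => //= i ->; rewrite linear0.
have /matrix0Pn[a [b sab]] : iter (n (tag t)).-1 e (v (tag t)) != 0.
  by apply/eqP; apply: v_socle.
have socE : (q + tagged t = (n (tag t)).-1)%N.
  by rewrite /q; have := ltn_ord (tagged t); lia.
have hab : (a + b = (d (tag t) + n (tag t)).-1)%N.
  apply/eqP; apply: contraTT sab => ne; rewrite negbK; apply/eqP.
  apply: iter_homog; first exact: v_homog.
  by move=> E; move: ne; rewrite E; have := ltn_ord (tagged t); lia.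
move/matrixP/(_ a b); rewrite summxE (bigD1 t) //= !mxE -iterD socE big1.
  by move/eqP; rewrite addr0 mulf_eq0 (negPf sab) orbF (negPf ct).
(* A term t' which does not vanish at (a, b) must be t itself: by maximality it
   has become a last vector, and its degree then identifies its string. *)
move=> t' t't; rewrite !mxE -iterD.
have [->|ct'] := eqVneq (c t') 0; first by rewrite mul0r.
have le_t' : (ht t' <= ht t)%N := t_max t' ct'; rewrite /ht in le_t'.
have lt_t := ltn_ord (tagged t); have lt_t' := ltn_ord (tagged t').
have [le_n|lt_n] := leqP (n (tag t')) (q + tagged t').
  by rewrite (iter_eq0 le_n) ?mxE ?mulr0.
rewrite (iter_homog (@v_homog (tag t'))) ?mulr0 // hab => E.
rewrite /q in lt_n E.
have tops (x y i x' y' i' : nat) : (i < y)%N -> (i' < y')%N ->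
    (y' - i' <= y - i)%N -> (y - i.+1 + i' < y')%N ->
    (x + y).-1 = (x' + (y - i.+1 + i'))%N ->
  (x + y = x' + y')%N /\ (y = y' -> i = i') by lia.
have [/socle_inj tag_t idx_t] := tops _ _ _ _ _ _ lt_t lt_t' le_t' lt_n E.
case/eqP: t't; apply: tagged_ord_inj; first exact: esym.
by apply/esym/idx_t; rewrite tag_t.
Qed.

Lemma string_span : (\sum_i n i = l * m)%N ->
  forall X, exists c : {ffun T -> k},
    X = \sum_t c t *: iter (tagged t) e (v (tag t)).
Proof.
move=> sum_n X.
pose s (c : {ffun T -> k^o}) :=
  \sum_t (c t : k) *: iter (tagged t) e (v (tag t)).
have s_lin : linear s.
  move=> a c c'; rewrite /s scaler_sumr -big_split; apply: eq_bigr => t _.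
  by rewrite !ffunE scalerDl scalerA.
pose sL := GRing.isLinear.Build k _ _ _ s s_lin.
pose S : {linear _ -> _} := HB.pack s sL.
have S_inj : injective (linfun S).
  move=> c c'; rewrite !lfunE /= => /eqP; rewrite -subr_eq0.
  have -> : s c - s c' = s (c - c').
    by rewrite -[s c']scale1r -scaleNr addrC -s_lin scaleN1r addrC.
  move=> /eqP/string_free cc'; apply/ffunP=> t.
  by have /eqP := cc' t; rewrite !ffunE subr_eq0 => /eqP.
have /limg_dim_eq : (fullv :&: lker (linfun S) = 0)%VS.
  by move/lker0P/eqP: S_inj => ->; rewrite capv0.
have -> : \dim {: {ffun T -> k^o}} = \dim {: 'M[k]_(l, m)}.
  rewrite !dimvf dim_matrix.
  have -> : dim {ffun T -> k^o} = (#|{: T}| * 1)%N by [].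
  rewrite muln1 card_tagged sumnE big_map big_enum /= -[RHS]/(l * m)%N -sum_n.
  by apply: eq_bigr => i _; rewrite card_ord.
move=> dim_S; have /eqP lim : limg (linfun S) == fullv.
  by rewrite eqEdim subvf dim_S leqnn.
have : X \in limg (linfun S) by rewrite lim memvf.
by case/memv_imgP=> c _ ->; exists c; rewrite lfunE.
Qed.

Lemma strings_inj (x y : forall i, 'cV[k]_(n i)) :
  \sum_i string_map e (v i) (x i) = \sum_i string_map e (v i) (y i) ->
  forall i, x i = y i.
Proof.
rewrite /string_map !sig_big_dep /= => /eqP; rewrite -subr_eq0 -sumrB.
move=> /eqP xy.
have free0 := @string_free
  (fun t => x (tag t) (tagged t) 0 - y (tag t) (tagged t) 0).
move=> i; apply/colP=> j; apply/eqP; rewrite -subr_eq0; apply/eqP.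
apply: (free0 _ (Tagged (fun i => 'I_(n i)) j)); rewrite -[RHS]xy.
by apply: eq_bigr => t _; rewrite scalerBl.
Qed.

Lemma strings_surj : (\sum_i n i = l * m)%N ->
  forall X, exists x : forall i, 'cV[k]_(n i),
    \sum_i string_map e (v i) (x i) = X.
Proof.
move=> sum_n X; have [c ->] := string_span sum_n X.
exists (fun i => \col_j c (Tagged (fun i => 'I_(n i)) j)).
rewrite /string_map sig_big_dep /=; apply: eq_bigr => -[i j] _ /=.
by rewrite mxE.
Qed.

End Strings.

(** * Strings in k[x,y]/(x^l, y^m) *)

Section Ladder.
Variables (k : fieldType) (p l m : nat).
Hypotheses (le_lp : (l <= p)%N) (le_mp : (m <= p)%N).
Implicit Types X v : 'M[k]_(l, m).

Definition lowering_mx n : 'M[k]_n :=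
  \matrix_(a, b) ((a.+1 == b)%:R * (b * (n - b))%N%:R).

(** [raise] and [lower] are the operators E and F. *)
Definition raise : 'M[k]_(l, m) -> 'M[k]_(l, m) := ksum (Mu k p l) (Mu k p m).
Definition lower : 'M[k]_(l, m) -> 'M[k]_(l, m) :=
  ksum (lowering_mx l) (lowering_mx m).
HB.instance Definition _ := GRing.Linear.on raise.
HB.instance Definition _ := GRing.Linear.on lower.

Lemma MuE n (a b : 'I_n) : (n <= p)%N -> Mu k p n a b = (a == b.+1 :> nat)%:R.
Proof. by move=> le_np; rewrite /Mu le_np mxE. Qed.

Lemma raiseE X a b :
  raise X a b = \sum_(c < l) (a == c.+1 :> nat)%:R * X c b
                + \sum_(c < m) (b == c.+1 :> nat)%:R * X a c.
Proof.
rewrite !mxE; congr (_ + _); apply: eq_bigr => c _; first by rewrite MuE.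
by rewrite mxE MuE // mulrC.
Qed.

Lemma lowerE X a b :
  lower X a b = \sum_(c < l) (a.+1 == c)%:R * ((c * (l - c))%N%:R * X c b)
                + \sum_(c < m) (b.+1 == c)%:R * ((c * (m - c))%N%:R * X a c).
Proof.
rewrite !mxE; congr (_ + _); apply: eq_bigr => c _; first by rewrite mxE mulrA.
by rewrite !mxE mulrC mulrA.
Qed.

Lemma raise_homog d X : homog d X -> homog d.+1 (raise X).
Proof.
move=> dX a b ne; rewrite raiseE !big1 ?addr0 // => c _.
- by case: eqP => [bc|_]; rewrite ?mul0r // mul1r; apply: dX; lia.
- by case: eqP => [ac|_]; rewrite ?mul0r // mul1r; apply: dX; lia.
Qed.

(** On x^a the two products are (a+1)(n-a-1) and a(n-a), and their difference
    is n - 1 - 2a: the weights of sl2 on its n-dimensional representation. *)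
Lemma lowering_commutator n : (n <= p)%N ->
  lowering_mx n *m Mu k p n - Mu k p n *m lowering_mx n
  = diag_mx (\row_a (n.-1%:R - a.*2%:R)).
Proof.
move=> le_np; apply/matrixP=> a b; rewrite !mxE.
have -> : \sum_j lowering_mx n a j * Mu k p n j b
        = (a == b)%:R * (a.+1 * (n - a.+1))%N%:R.
  under eq_bigr => c _ do rewrite MuE // mxE -mulrA.
  rewrite (sum_ord_pick _ _ (fun c => (c * (n - c))%N%:R * (c == b.+1)%:R)).
  rewrite eqSS mulrC; case: ltnP => // le_na.
  by rewrite (_ : n - a.+1 = 0)%N ?muln0 ?mulr0 //; lia.
have -> : \sum_j Mu k p n a j * lowering_mx n j b
        = (a == b)%:R * (a * (n - a))%N%:R.
  under eq_bigr => c _ do rewrite MuE // mxE mulrC -mulrA.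
  under eq_bigr => c _ do rewrite eq_sym.
  rewrite (sum_ord_pred (fun c => (b * (n - b))%N%:R * (a == c.+1 :> nat)%:R))
    ?(ltnW (ltn_ord _)) //.
  rewrite -val_eqE /=; have [->|b_gt0] := posnP b.
    by rewrite mul0n !mul0r; case: eqP => [->|_]; rewrite ?mul0r ?mulr0.
  by rewrite prednK //; case: eqP => [->|_]; rewrite ?mulr1 ?mulr0 ?mul0r.
rewrite -mulrBr mulr_natl; congr (_ *+ _).
apply/eqP; rewrite subr_eq addrAC eq_sym subr_eq -!natrD; apply/eqP.
by congr _%:R; have := ltn_ord a; move: (nat_of_ord a) => i; nia.
Qed.

Lemma lower_raise d X : homog d X ->
  lower (raise X) = raise (lower X) + ((l.-1 + m.-1)%N%:R - d.*2%:R) *: X.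
Proof.
move=> dX; apply/eqP; rewrite addrC -subr_eq; apply/eqP.
rewrite ksum_commutator !lowering_commutator // /ksum tr_diag_mx.
rewrite mul_diag_mx mul_mx_diag; apply/matrixP=> a b; rewrite !mxE.
have [ab|/eqP ne] := eqVneq (a + b)%N d; last first.
  by rewrite dX // !(mulr0, mul0r) addr0.
rewrite [X in _ + X]mulrC -mulrDl; congr (_ * _).
by rewrite -ab -!addnn !natrD; ring.
Qed.

(** The scalar is the sum of the weights N, N - 2, ..., N - 2j met when F is
    moved past the j + 1 factors E, until it reaches v and kills it. *)
Lemma lower_iter_raise d N v j : homog d v -> lower v = 0 ->
  (d.*2 + N = l.-1 + m.-1)%N -> (j <= N)%N ->
  lower (iter j.+1 raise v) = (j.+1 * (N - j))%N%:R *: iter j raise v.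
Proof.
move=> dv v0 dN; have lr i := lower_raise (iter_homog (n := i) raise_homog dv).
elim: j => [|j IHj] le_j; rewrite iterS lr -dN.
  rewrite v0 linear0 add0r mul1n subn0 addn0; congr (_ *: _).
  by rewrite natrD; ring.
rewrite IHj ?(ltnW le_j) // linearZ -scalerDl; congr (_ *: _).
by apply/eqP; rewrite addrA subr_eq -!natrD; apply/eqP; congr _%:R; nia.
Qed.

Hypothesis hp : p \in [pchar k].

Lemma iter_raise_neq0 d N v j : homog d v -> lower v = 0 -> v <> 0 ->
  (d.*2 + N = l.-1 + m.-1)%N -> (N < p)%N -> (j <= N)%N ->
  iter j raise v <> 0.
Proof.
move=> dv v0 v_neq0 dN lt_Np; elim: j => [//|j IHj] lt_jN Ev.
apply: IHj (ltnW lt_jN) _.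
have := lower_iter_raise dv v0 dN (ltnW lt_jN).
rewrite Ev linear0 natrM => /esym/eqP; rewrite scaler_eq0 mulf_eq0.
by rewrite !(negPf (natr_neq0 hp _)) /= ?(eqP _) //; [move/eqP | lia | lia].
Qed.

(** In degree d >= l every monomial x^a y^b of A has b > 0. The coefficient of
    x^a y^(b-1) in F X is b(m-b) X_(a,b) plus a multiple of X_(a+1,b-1), and
    b(m-b) is nonzero in k because 0 < b < m <= p; so the entries of X vanish by
    descending induction on a. *)
Lemma lower_inj d X : homog d X -> (l <= d)%N -> lower X = 0 -> X = 0.
Proof.
move=> dX le_ld X0; apply/matrixP=> a b; rewrite mxE.
have [q le_q] : exists q, (l - a <= q)%N by exists (l - a)%N.
elim: q a b le_q => [|q IHq] a b le_q; first by have := ltn_ord a; lia.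
have [ab|/eqP ne] := eqVneq (a + b)%N d; last exact: dX.
have lt_al := ltn_ord a; have lt_bm := ltn_ord b.
have b_gt0 : (0 < b)%N by lia.
have lt_b'm : (b.-1 < m)%N by lia.
have /matrixP/(_ a (Ordinal lt_b'm)) := X0.
rewrite lowerE mxE big1 => [|c _]; last first.
  have [ac|ne] := eqVneq a.+1 c; last by rewrite mul0r.
  by rewrite IHq ?mulr0 // -ac; lia.
rewrite add0r (bigD1 b) //= prednK // eqxx mul1r big1 => [|c ne]; last first.
  by rewrite -val_eqE eq_sym /= in ne; rewrite (negPf ne) mul0r.
have /negPf bN0 : b%:R != 0 :> k by apply: (natr_neq0 hp); lia.
have /negPf mbN0 : (m - b)%N%:R != 0 :> k by apply: (natr_neq0 hp); lia.
by move/eqP; rewrite addr0 natrM !mulf_eq0 bN0 mbN0 => /eqP.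
Qed.

Lemma iter_raise_top d N v : homog d v -> lower v = 0 ->
  (d.*2 + N = l.-1 + m.-1)%N -> (l <= d + N.+1)%N ->
  iter N.+1 raise v = 0.
Proof.
move=> dv v0 dN le_l.
apply: (lower_inj (iter_homog (n := N.+1) raise_homog dv)) => //.
by rewrite (lower_iter_raise dv v0 dN (leqnn N)) subnn muln0 scale0r.
Qed.

(** In degree d the equation F v = 0 is a recursion
    (a+1)(l-a-1) c_(a+1) = - (d-a)(m-d+a) c_a between the coefficients c_a of
    x^a y^(d-a); this is the solution with c_0 = 1. *)
Definition primitive_vector d : 'M[k]_(l, m) :=
  \matrix_(a, b) ((a + b == d)%N%:R *
    \prod_(i < a)
      (- ((d - i) * (m - (d - i)))%N%:R / (i.+1 * (l - i.+1))%N%:R)).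

Lemma primitive_homog d : homog d (primitive_vector d).
Proof. by move=> a b /eqP/negPf ne; rewrite mxE ne mul0r. Qed.

Lemma primitive_neq0 d : (0 < l)%N -> (d < m)%N -> primitive_vector d <> 0.
Proof.
move=> l_gt0 lt_dm /matrixP/(_ (Ordinal l_gt0) (Ordinal lt_dm)).
by rewrite !mxE /= eqxx big_ord0 mulr1 => /eqP; rewrite oner_eq0.
Qed.

Lemma lower_primitive d : (d < l)%N -> (d < m)%N ->
  lower (primitive_vector d) = 0.
Proof.
move=> lt_dl lt_dm; apply/matrixP=> a b; rewrite lowerE mxE.
have [ab|ne] := eqVneq (a + b).+1 d; last first.
  rewrite !big1 ?addr0 // => c _; have [ac|] := eqVneq _ (c : nat);
    rewrite ?mul0r //.
    by rewrite primitive_homog ?mulr0 // -ac => E; case/eqP: ne; lia.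
  by rewrite primitive_homog ?mulr0 // -ac => E; case/eqP: ne; lia.
have lt_al : (a.+1 < l)%N by lia.
have lt_bm : (b.+1 < m)%N by lia.
rewrite (bigD1 (Ordinal lt_al)) //= [X in _ + X](bigD1 (Ordinal lt_bm)) //=.
rewrite !big1 ?addr0 => [|c ne|c ne]; try
  by rewrite -val_eqE eq_sym /= in ne; rewrite (negPf ne) mul0r.
rewrite !eqxx !mul1r !mxE /= addSn addnS ab eqxx !mul1r big_ord_recr /=.
have -> : (d - a = b.+1)%N by lia.
have : (a.+1 * (l - a.+1))%N%:R != 0 :> k.
  by rewrite natrM mulf_neq0 //; apply: (natr_neq0 hp); lia.
set P := \prod_(i < a) _; move: P => P.
move: (a.+1 * _)%N (b.+1 * _)%N => x y x_neq0; field.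
exact: x_neq0.
Qed.

Definition y_power d : 'M[k]_(l, m) :=
  \matrix_(a, b) ((a == 0%N :> nat) && (b == d :> nat))%:R.

Lemma y_power_homog d : homog d (y_power d).
Proof.
move=> a b ne; rewrite mxE; case: eqP ne => //= ->.
by rewrite add0n => /eqP/negPf ->.
Qed.

(** The binomial expansion of (x+y)^n y^d. *)
Lemma iter_raise_y_power d n (a : 'I_l) (b : 'I_m) :
  iter n raise (y_power d) a b = ((a + b == n + d)%N * 'C(n, a))%N%:R.
Proof.
elim: n a b => [|n IHn] a b.
  rewrite mxE bin0n add0n.
  by case: (nat_of_ord a) => [|a']; rewrite ?muln0 ?muln1.
rewrite iterS raiseE.
under eq_bigr => c _ do rewrite IHn.
rewrite (sum_ord_pred (fun c => ((c + b == n + d)%N * 'C(n, c))%N%:R))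
  ?(ltnW (ltn_ord _)) //.
under eq_bigr => c _ do rewrite IHn.
rewrite (sum_ord_pred (fun c => ((a + c == n + d)%N * 'C(n, a))%N%:R))
  ?(ltnW (ltn_ord _)) //.
rewrite -!natrM -natrD; congr _%:R; rewrite addSn.
case: (nat_of_ord a) (nat_of_ord b) => [|a'] [|b'] /=; rewrite ?mul0n ?mul1n //.
- by rewrite !add0n eqSS !bin0.
- rewrite !addn0 eqSS binS; case: eqP => [->|_]; rewrite ?mul0n ?mul1n //.
  by rewrite [in RHS]bin_small // ltnS leq_addr.
- by rewrite !addnS !addSn !eqSS -mulnDr binS [('C(n, a') + _)%N]addnC.
Qed.

Lemma iter_raise_y_power_p d : (m <= p + d)%N -> iter p raise (y_power d) = 0.
Proof.
move=> le_mpd; apply/matrixP=> a b; rewrite iter_raise_y_power mxE.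
have lt_bm := ltn_ord b; have lt_al := ltn_ord a.
case: eqP => [ab|_]; last by rewrite mul0n.
have /andP[a_gt0 lt_ap] : (0 < a < p)%N by lia.
apply/eqP; rewrite mul1n -(dvdn_pcharf hp).
by rewrite prime_dvd_bin ?(pcharf_prime hp) // a_gt0.
Qed.

Lemma iter_raise_y_power_neq0 d : (d + p < l + m)%N ->
  iter p.-1 raise (y_power d) <> 0.
Proof.
move=> lt_d; have p_gt0 := prime_gt0 (pcharf_prime hp).
(* The monomial x^(l-1) y^(d+p-l). *)
have lt_al : (l.-1 < l)%N by lia.
have lt_bm : (d + p - l < m)%N by lia.
move/matrixP/(_ (Ordinal lt_al) (Ordinal lt_bm)).
rewrite iter_raise_y_power mxE /= (_ : _ == _); last by apply/eqP; lia.
by apply/eqP; rewrite mul1n; apply: (bin_pred_neq0 hp); lia.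
Qed.

End Ladder.

(** * Modules realized on a vector space with operators *)

Section Realization.
Variables (k : fieldType) (p : nat) (hp : p \in [pchar k]).
Variables (Z : lmodType k) (eu ew : {linear Z -> Z}).

(** For bijective phi: V is a copy of Z with u acting by eu and w by ew. *)
Definition realizes (V : lmodType (U hp)) (phi : V -> Z) : Prop :=
  [/\ {morph phi : x y / x + y},
      forall c x, phi ((c%:A : U hp) *: x) = c *: phi x,
      forall x, phi (gen_u hp *: x) = eu (phi x)
    & forall x, phi (gen_w hp *: x) = ew (phi x)].

(** The elements of U that act compatibly through phi and psi are closed under
    sums and products and contain the generators, so they are all of U. *)
Lemma realizes_mod_iso (V W : lmodType (U hp)) (phi : V -> Z) (psi : W -> Z) :
  realizes phi -> bijective phi -> realizes psi -> bijective psi ->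
  mod_iso V W.
Proof.
move=> [phiD phiZ phiu phiw] [phi' phiK phi'K].
move=> [psiD psiZ psiu psiw] [psi' psiK psi'K].
have act (h : U hp) x y : phi x = psi y -> phi (h *: x) = psi (h *: y).
  elim/U_ind: h x y => [||c|g h IHg IHh|g h IHg IHh] x y E.
  - by rewrite phiu psiu E.
  - by rewrite phiw psiw E.
  - have -> : uconst hp c = c%:A by rewrite -[RHS]/(uconst hp c * 1) mulr1.
    by rewrite phiZ psiZ E.
  - by rewrite !scalerDl phiD psiD (IHg _ _ E) (IHh _ _ E).
  - by rewrite -!scalerA; apply/IHg/IHh.
pose f x := psi' (phi x).
have f_lin : linear f.
  move=> h x y; apply: (can_inj psiK); rewrite psiD psi'K phiD.
  by rewrite (act h x (f x)) !psi'K.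
pose fL := GRing.isLinear.Build (U hp) V W _ f f_lin.
pose F : {linear V -> W} := HB.pack f fL.
exists F; exists (fun y => phi' (psi y)) => x.
  by rewrite /= psi'K phiK.
by rewrite /= /f phi'K psiK.
Qed.

Lemma realizes_dsum n (V : 'I_n -> lmodType (U hp)) (psi : forall i, V i -> Z) :
  (forall i, realizes (psi i)) ->
  @realizes (dsum V) (fun f => \sum_i psi i (f i)).
Proof.
move=> psiR; split=> [f g|c f|f|f]; rewrite ?linear_sum.
- rewrite -big_split; apply: eq_bigr => i _.
  by rewrite ffunE; case: (psiR i) => ->.
- apply: eq_bigr => i _.
  by rewrite ffunE; case: (psiR i) => _ ->.
- by apply: eq_bigr => i _; rewrite ffunE; case: (psiR i) => _ _ ->.
- by apply: eq_bigr => i _; rewrite ffunE; case: (psiR i) => _ _ _ ->.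
Qed.

Lemma realizes_pair (V W : lmodType (U hp)) (phi : V -> Z) (psi : W -> Z) :
  realizes phi -> realizes psi ->
  @realizes (V * W)%type (fun x => phi x.1 + psi x.2).
Proof.
move=> [phiD phiZ phiu phiw] [psiD psiZ psiu psiw].
split=> [x y|c x|x|x] /=; rewrite ?linearD.
- by rewrite phiD psiD addrACA.
- by rewrite phiZ psiZ.
- by rewrite phiu psiu.
- by rewrite phiw psiw.
Qed.

(** The vectors v, eu v, ..., eu^(n-1) v satisfy the relations of the standard
    basis of M(n, rho). *)
Lemma realizes_string n (rho : 'F_p) (v : Z) : (n <= p)%N ->
  iter n eu v = 0 ->
  (forall j, ew (iter j eu v) = (rho + j)%N%:R *: iter j eu v) ->
  @realizes (M hp n rho) (string_map eu v).
Proof.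
move=> le_np v0 vw; rewrite /string_map.
split=> [x y|c x|x|x].
- rewrite -big_split; apply: eq_bigr => j _.
  by rewrite -[(x + y) j 0]/((x + y : 'cV[k]_n) j 0) mxE scalerDl.
- rewrite M_scalar scaler_sumr; apply: eq_bigr => j _.
  by rewrite mxE scalerA.
- rewrite M_u linear_sum.
  transitivity (\sum_(i < n) \sum_(j < n)
     (i == j.+1 :> nat)%:R *: (x j 0 *: iter i eu v)).
    apply: eq_bigr => i _; rewrite mxE scaler_suml; apply: eq_bigr => j _.
    by rewrite MuE // scalerA.
  rewrite exchange_big; apply: eq_bigr => j _ /=; rewrite linearZ -iterS.
  have [lt_jn|] := ltnP j.+1 n.
    rewrite (bigD1 (Ordinal lt_jn)) //= eqxx scale1r big1 ?addr0 // => i ne.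
    by rewrite -val_eqE /= in ne; rewrite (negPf ne) scale0r.
  move=> le_nj; have -> : j.+1 = n by apply/eqP; rewrite eqn_leq le_nj ltn_ord.
  rewrite v0 /= scaler0 big1 // => i _.
  by rewrite ltn_eqF ?scale0r // ltn_ord.
- rewrite M_w linear_sum; apply: eq_bigr => j _; rewrite linearZ vw.
  by rewrite /Mw mul_diag_mx !mxE mulrC -scalerA.
Qed.

End Realization.

(** * The tensor product of two standard modules *)

Section TensorSums.
Variables (k : fieldType) (A B Z : lmodType k).

Lemma tpure_suml (I : finType) (F : I -> A) (w : B) :
  tpure (\sum_i F i) w = \sum_i tpure (F i) w.
Proof.
apply: (big_morph (fun v => tpure v w)) => [v v'|]; first exact: tpureDl.
exact: bilinear0l (@tpure_bilinear k A B).
Qed.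

Lemma tpure_sumr (v : A) (I : finType) (F : I -> B) :
  tpure v (\sum_i F i) = \sum_i tpure v (F i).
Proof.
apply: (big_morph (tpure v)) => [w w'|]; first exact: tpureDr.
exact: bilinear0r (@tpure_bilinear k A B).
Qed.

Lemma tlift_sum (f : A -> B -> Z) (I : finType) (F : I -> tensor A B) :
  bilinear_fun f -> tlift f (\sum_i F i) = \sum_i tlift f (F i).
Proof.
move=> fB; apply: big_morph => [x y|]; [exact: tliftD | exact: tlift0].
Qed.

End TensorSums.

Section TensorRealization.
Variables (k : fieldType) (p : nat) (hp : p \in [pchar k]).
Variables (l m : nat) (r r' : 'F_p).

Local Notation V := (M hp l r).
Local Notation W := (M hp m r').

Definition outer (v : restr V) (w : restr W) : 'M[k]_(l, m) :=
  (v : 'cV[k]_l) *m (w : 'cV[k]_m)^T.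

Lemma restr_scale n i (c : k) (v : restr (M hp n i)) :
  c *: v = c *: (v : 'cV[k]_n).
Proof. exact: M_scalar. Qed.

Lemma restr_basis n i (v : restr (M hp n i)) :
  v = \sum_j (v : 'cV[k]_n) j 0
               *: ((delta_mx j 0 : 'cV[k]_n) : restr (M hp n i)).
Proof.
have vE : (v : 'cV[k]_n) = \sum_j (v : 'cV[k]_n) j 0 *: delta_mx j 0.
  rewrite {1}[v : 'cV[k]_n]matrix_sum_delta; apply: eq_bigr => j _.
  by rewrite big_ord1.
by rewrite {1}vE; apply: eq_bigr => j _; rewrite restr_scale.
Qed.

Lemma outer_bilinear : bilinear_fun outer.
Proof.
split=> [v v' w|v w w'|c v w|c v w]; rewrite /outer ?restr_scale.
- exact: mulmxDl.
- rewrite [X in X^T](_ : _ = (w : 'cV[k]_m) + (w' : 'cV[k]_m)) //.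
  by rewrite linearD mulmxDr.
- by rewrite scalemxAl.
- by rewrite linearZ scalemxAr.
Qed.

Definition tensor_mx : mtensor V W -> 'M[k]_(l, m) := tlift outer.

Definition weight : 'M[k]_(l, m) -> 'M[k]_(l, m) := ksum (Mw k l r) (Mw k m r').
HB.instance Definition _ := GRing.Linear.on weight.

(** An element h acts k-linearly on the tensor product, so its action is
    determined on pure tensors. *)
Lemma tensor_mx_act (h : U hp) (A : {linear 'M[k]_(l, m) -> 'M[k]_(l, m)}) :
  (forall (v : V) (w : W),
    tensor_mx (h *: (tpure (v : restr V) (w : restr W) : mtensor V W))
    = A (outer v w)) ->
  forall x, tensor_mx (h *: x) = A (tensor_mx x).
Proof.
have [_ _ _ Z] :=
  tact_bilinear (@ract_bilinear k (U hp) V) (@ract_bilinear k (U hp) W).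
have oB := outer_bilinear.
move=> hA; elim/tensor_ind => [|v w|x y IHx IHy|c x IHx].
- by rewrite scaler0 /tensor_mx !(tlift0 oB) linear0.
- by rewrite hA /tensor_mx (tlift_pure oB).
- rewrite [h *: _]scalerDr /tensor_mx !(tliftD oB) linearD.
  by congr (_ + _).
- rewrite -[h *: _]/(mtscale h (c *: x)) /mtscale Z /tensor_mx.
  rewrite !(tliftZ oB) linearZ /=.
  by congr (_ *: _).
Qed.

Lemma mtensor_const (c : k) (x : mtensor V W) :
  (c%:A : U hp) *: x = c *: (x : tensor (restr V) (restr W)).
Proof.
have [_ _ Z _] :=
  tact_bilinear (@ract_bilinear k (U hp) V) (@ract_bilinear k (U hp) W).
have -> : (c%:A : U hp) = uconst hp c by rewrite -[LHS]/(uconst hp c * 1) mulr1.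
rewrite -[LHS]/(tact _ _ (cop (uconst hp c)) x) cop_const /tconst Z -(cop1 hp).
exact: (congr1 (fun y : tensor (restr V) (restr W) => c *: y) (scale1r x)).
Qed.

Lemma tensor_mx_realizes : @realizes k p hp _
  (@raise k p l m) weight (mtensor V W) tensor_mx.
Proof.
have oB := outer_bilinear.
split=> [x y|c x|x|x].
- exact: tliftD.
- by rewrite mtensor_const; apply: tliftZ.
- apply: tensor_mx_act => v w; rewrite mtensor_u /tensor_mx (tliftD oB).
  rewrite !(tlift_pure oB) /outer !M_u trmx_mul mulmxA.
  by rewrite -[RHS]/(ksum _ _ _) /ksum !mulmxA.
- apply: tensor_mx_act => v w; rewrite mtensor_w /tensor_mx (tliftD oB).
  rewrite !(tlift_pure oB) /outer !M_w trmx_mul mulmxA.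
  by rewrite -[RHS]/(ksum _ _ _) /ksum !mulmxA.
Qed.

Lemma tensor_mx_bij : bijective tensor_mx.
Proof.
have oB := outer_bilinear.
pose E i j : tensor (restr V) (restr W) :=
  @tpure k (restr V) (restr W)
    (delta_mx i 0 : 'cV[k]_l) (delta_mx j 0 : 'cV[k]_m).
pose g (X : 'M[k]_(l, m)) : mtensor V W := \sum_i \sum_j X i j *: E i j.
have gD X Y : g (X + Y) = g X + g Y.
  rewrite /g -big_split; apply: eq_bigr => i _; rewrite -big_split.
  by apply: eq_bigr => j _; rewrite mxE scalerDl.
have gZ c X : g (c *: X) = c *: (g X : tensor _ _).
  rewrite /g scaler_sumr; apply: eq_bigr => i _; rewrite scaler_sumr.
  by apply: eq_bigr => j _; rewrite mxE scalerA.
exists g => [x|X].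
  elim/tensor_ind: x => [|v w|x y IHx IHy|c x IHx].
  - rewrite /tensor_mx (tlift0 oB) /g big1 // => i _; rewrite big1 // => j _.
    by rewrite mxE scale0r.
  - rewrite /tensor_mx (tlift_pure oB) /g.
    rewrite [in RHS](restr_basis v) tpure_suml; apply: eq_bigr => i _.
    rewrite [in RHS](restr_basis w) tpure_sumr; apply: eq_bigr => j _.
    by rewrite mxE big_ord1 !mxE tpureZl tpureZr scalerA.
  - rewrite /tensor_mx (tliftD oB) gD.
    exact: (congr2 (fun a b : tensor (restr V) (restr W) => a + b) IHx IHy).
  - rewrite /tensor_mx (tliftZ oB) gZ.
    exact: (congr1 (fun a : tensor (restr V) (restr W) => c *: a) IHx).
rewrite /tensor_mx /g (tlift_sum _ oB) {2}[X]matrix_sum_delta.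
apply: eq_bigr => i _; rewrite (tlift_sum _ oB); apply: eq_bigr => j _.
rewrite (tliftZ oB) (tlift_pure oB).
congr (_ *: _); rewrite /outer; apply/matrixP=> a b; rewrite !mxE big_ord1 !mxE.
by rewrite !eqxx !andbT mulr_natl mulrb; case: (a == i); case: (b == j).
Qed.

End TensorRealization.

(** * The decomposition *)

Lemma weight_homog (k : fieldType) (p l m : nat) (r r' : 'F_p) d
    (X : 'M[k]_(l, m)) :
  homog d X -> weight r r' X = (r + r' + d)%N%:R *: X.
Proof.
move=> dX; rewrite /weight /ksum /Mw tr_diag_mx mul_diag_mx mul_mx_diag.
apply/matrixP=> a b; rewrite !mxE.
have [<-|/eqP ne] := eqVneq (a + b)%N d; last first.
  by rewrite dX // !(mulr0, mul0r) addr0.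
by rewrite [X in _ + X]mulrC -mulrDl -natrD addnACA.
Qed.

Section GradedStrings.
Variables (k : fieldType) (p : nat) (hp : p \in [pchar k]).
Variables (l m : nat) (le_lp : (l <= p)%N) (le_mp : (m <= p)%N) (r r' : 'F_p).

Local Notation raise := (@raise k p l m).

Lemma realizes_graded_string d n (rho : 'F_p) (v : 'M[k]_(l, m)) :
  homog d v -> (n <= p)%N -> iter n raise v = 0 ->
  (rho%:R = (r + r' + d)%N%:R :> k) ->
  @realizes k p hp _ raise (weight r r') (M hp n rho) (string_map raise v).
Proof.
move=> dv le_np v0 rhoE; apply: realizes_string => // j.
rewrite -[LHS]/(weight r r' _).
rewrite (weight_homog _ _ (iter_homog (n := j) (raise_homog le_lp le_mp) dv)).
by rewrite [in RHS]natrD rhoE -natrD addnA.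
Qed.

End GradedStrings.

Lemma inj_surj_bij (A B : choiceType) (f : A -> B) :
  injective f -> (forall y, exists x, f x = y) -> bijective f.
Proof.
move=> f_inj f_surj.
have f_surjb y : exists x, f x == y by have [x <-] := f_surj y; exists x.
exists (fun y => xchoose (f_surjb y)) => [x|y].
  exact/f_inj/eqP/(xchooseP (f_surjb (f x))).
exact/eqP/(xchooseP (f_surjb y)).
Qed.

Section Decomposition.
Variables (k : fieldType) (p : nat) (hp : p \in [pchar k]).
Variables (l m : nat) (r r' : 'F_p).
Hypotheses (l_gt0 : (0 < l)%N) (le_lm : (l <= m)%N) (le_mp : (m <= p)%N).

Let le_lp : (l <= p)%N. Proof. exact: leq_trans le_mp. Qed.

Local Notation raise := (@raise k p l m).
Local Notation raise_homog := (@raise_homog k p l m le_lp le_mp).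

(* The summand with index i (counted from 0) starts in degree d = l - 1 - i, and
   its length l + m - 1 - 2d is m + 2(i+1) - l - 1. *)
Local Notation short_len i := (m + 2 * i.+1 - l - 1)%N.
Local Notation short_vec i := (primitive_vector k l m (l - i.+1)%N).

Lemma short_string (i : nat) : (i < l)%N -> (short_len i <= p)%N ->
  iter (short_len i) raise (short_vec i) = 0 /\
  iter (short_len i).-1 raise (short_vec i) <> 0.
Proof.
move=> lt_il le_np.
have [N NE] : exists N, short_len i = N.+1 by exists (short_len i).-1; lia.
rewrite NE /=.
have dN : ((l - i.+1).*2 + N = l.-1 + m.-1)%N by lia.
have dv := @primitive_homog k l m (l - i.+1)%N.
have v0 : lower (short_vec i) = 0.
  by apply: (lower_primitive le_lp le_mp hp); lia.
split; first by apply: (iter_raise_top le_lp le_mp hp dv v0 dN); lia.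
apply: (iter_raise_neq0 le_lp le_mp hp dv v0 _ dN) => //; last by lia.
by apply: primitive_neq0; lia.
Qed.

Lemma short_weight (i : nat) : (i < l)%N ->
  ((r + r' + l%:R - i.+1%:R)%R : 'F_p)%:R = (r + r' + (l - i.+1))%N%:R :> k.
Proof.
move=> lt_il; rewrite -addrA -natrB // !(Fp_natrD hp) (Fp_natr hp).
by rewrite !natrD.
Qed.

Lemma long_weight (i : nat) :
  ((r + r' + i.+1%:R - 1)%R : 'F_p)%:R = (r + r' + i)%N%:R :> k.
Proof.
by rewrite -addrA -natr1 addrK !(Fp_natrD hp) (Fp_natr hp) !natrD.
Qed.

Lemma short_realizes (i : nat) : (i < l)%N -> (short_len i <= p)%N ->
  @realizes k p hp _ raise (weight r r')
    (M hp (short_len i) (r + r' + l%:R - i.+1%:R))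
    (string_map raise (short_vec i)).
Proof.
move=> lt_il le_np.
apply: (@realizes_graded_string k p hp l m le_lp le_mp r r' (l - i.+1)%N) => //.
- exact: primitive_homog.
- by case: (short_string lt_il le_np).
- exact: short_weight.
Qed.

Lemma long_realizes (i : nat) : (i < l + m - p)%N ->
  @realizes k p hp _ raise (weight r r') (M hp p (r + r' + i.+1%:R - 1))
    (string_map raise (y_power k l m i)).
Proof.
move=> lt_i.
apply: (@realizes_graded_string k p hp l m le_lp le_mp r r' i) => //.
- exact: y_power_homog.
- by apply: (iter_raise_y_power_p le_lp le_mp hp); lia.
- exact: long_weight.
Qed.

Lemma sum_odd n : (\sum_(i < n) (i.*2.+1) = n ^ 2)%N.
Proof.
elim: n => [|n IHn]; first by rewrite big_ord0.
by rewrite big_ord_recr /= IHn; nia.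
Qed.

Lemma sum_short_len n : (\sum_(i < n) short_len i = n * (m - l) + n ^ 2)%N.
Proof.
rewrite -sum_odd -[X in (X * _)%N]card_ord -sum_nat_const -big_split.
by apply: eq_bigr => i _ /=; lia.
Qed.

Lemma tensor_decomposition_small : (l + m <= p)%N ->
  mod_iso (mtensor (M hp l r) (M hp m r'))
          (dsum (fun i : 'I_l => M hp (short_len i) (r + r' + l%:R - i.+1%:R))).
Proof.
move=> le_lmp.
have len (i : 'I_l) : (short_len i <= p)%N by have := ltn_ord i; lia.
have str i := short_string (ltn_ord i) (len i).
have psiR (i : 'I_l) := short_realizes (ltn_ord i) (len i).
apply: (realizes_mod_iso (tensor_mx_realizes hp l m r r')
  (tensor_mx_bij hp l m r r') (realizes_dsum psiR)).
have socE : injective (fun i : 'I_l => (l - i.+1 + short_len i)%N).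
  move=> i j /= ij; apply: val_inj => /=.
  by have := ltn_ord i; have := ltn_ord j; lia.
have vh (i : 'I_l) := @primitive_homog k l m (l - i.+1)%N.
have v0 i := (str i).1; have v1 i := (str i).2.
apply: inj_surj_bij => [f g fg|X].
  apply/ffunP => i.
  exact: (strings_inj raise_homog vh v0 v1 socE fg i).
have [|x <-] := strings_surj raise_homog vh v0 v1 socE _ X.
  by rewrite sum_short_len; nia.
exists [ffun i => x i : M hp _ _].
by apply: eq_bigr => i _; rewrite ffunE.
Qed.

Lemma tensor_decomposition_large : (p < l + m)%N ->
  mod_iso (mtensor (M hp l r) (M hp m r'))
          (dsum (fun i : 'I_(p - m) =>
                   M hp (short_len i) (r + r' + l%:R - i.+1%:R))
           * dsum (fun i : 'I_(l + m - p) =>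
                     M hp p (r + r' + i.+1%:R - 1)))%type.
Proof.
move=> lt_plm.
pose I := ('I_(p - m) + 'I_(l + m - p))%type.
pose n (s : I) := match s with inl i => short_len i | inr _ => p end.
pose d (s : I) := match s with inl i => (l - i.+1)%N | inr i => i : nat end.
pose v (s : I) : 'M[k]_(l, m) :=
  match s with inl i => short_vec i | inr i => y_power k l m i end.
have lt_l (i : 'I_(p - m)) : (i < l)%N by have := ltn_ord i; lia.
have len (i : 'I_(p - m)) : (short_len i <= p)%N by have := ltn_ord i; lia.
have vh s : homog (d s) (v s).
  by case: s => i; [exact: primitive_homog | exact: y_power_homog].
have v0 s : iter (n s) raise (v s) = 0.
  case: s => i /=; first by case: (short_string (lt_l i) (len i)).
  by apply: (iter_raise_y_power_p le_lp le_mp hp); lia.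
have v1 s : iter (n s).-1 raise (v s) <> 0.
  case: s => i /=; first by case: (short_string (lt_l i) (len i)).
  by apply: (iter_raise_y_power_neq0 le_lp le_mp hp); have := ltn_ord i; lia.
have socE : injective (fun s => d s + n s)%N.
  move=> [i|i] [j|j] /= ij; have lt_i := ltn_ord i; have lt_j := ltn_ord j;
    try lia; by congr (_ _); apply: val_inj => /=; lia.
have psiR := realizes_pair
  (realizes_dsum (fun i => short_realizes (lt_l i) (len i)))
  (realizes_dsum (fun i => long_realizes (ltn_ord i))).
apply: (realizes_mod_iso (tensor_mx_realizes hp l m r r')
  (tensor_mx_bij hp l m r r') psiR).
apply: inj_surj_bij => [[f f'] [g g'] /= fg|X].
  pose h (x : dsum _) (x' : dsum _) (s : I) : 'cV[k]_(n s) :=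
    match s with inl i => x i | inr i => x' i end.
  have hE := @strings_inj k l m raise raise_homog I v n d vh v0 v1 socE
    (h f f') (h g g').
  rewrite !big_sumType /= in hE; have {}hE := hE fg.
  congr (_, _); apply/ffunP => i; [exact: (hE (inl i)) | exact: (hE (inr i))].
have [|x <-] := strings_surj raise_homog vh v0 v1 socE _ X.
  rewrite big_sumType /= sum_short_len sum_nat_const card_ord; nia.
exists ([ffun i => x (inl i) : M hp _ _], [ffun i => x (inr i) : M hp _ _]).
rewrite big_sumType /=.
by congr (_ + _); apply: eq_bigr => i _; rewrite ffunE.
Qed.

End Decomposition.

Theorem theorem0p2 (k : fieldType) (p : nat) (hp : p \in [pchar k])
    (r r' : 'F_p) :
  (forall l m : nat, (1 <= l)%N -> (l <= m)%N -> (m <= p)%N -> (l + m <= p)%N ->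
    mod_iso (mtensor (M hp l r) (M hp m r'))
            (dsum (fun i : 'I_l =>
               M hp (m + 2 * i.+1 - l - 1)
                    (r + r' + l%:R - i.+1%:R)))) /\
  (forall l m : nat, (1 <= l)%N -> (l <= m)%N -> (m <= p)%N -> (p < l + m)%N ->
    mod_iso (mtensor (M hp l r) (M hp m r'))
            (dsum (fun i : 'I_(p - m) =>
               M hp (m + 2 * i.+1 - l - 1)
                    (r + r' + l%:R - i.+1%:R))
             * dsum (fun i : 'I_(l + m - p) =>
               M hp p (r + r' + i.+1%:R - 1)))%type).
Proof.
split=> l m l_gt0 le_lm le_mp lmp.
  exact: tensor_decomposition_small.
exact: tensor_decomposition_large.
Qed.
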